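(* Suppose $\mu$, $\mathcal{B}$ and $\mathcal{M}_{\mathcal{B}}$ satisfy the following assumptions. (A1) $A_1(\mathcal{B})\subset A_p(\mathcal{B})$ and $[w]_{A_p}\le[w]_{A_1}$ for all $w\in A_1(\mathcal{B})$ and all $1<p<\infty$. (A2) $A_\infty(\mathcal{B})=\bigcup_{1<\delta<\infty}RH_\delta(\mathcal{B})$. (A3) For all $1<p<\infty$, $0<\|\mathcal{M}_{\mathcal{B}}\|_{L^p,L^p}<\infty$, and $\limsup_{p\to1^+}\|\mathcal{M}_{\mathcal{B}}\|_{L^p,L^p}=\infty$. (A4) There exist functions $\Delta:(1,\infty)\times[1,\infty)\to(1,\infty)$, non-increasing in each variable, and $K:(1,\infty)\times[1,\infty)\to(1,\infty)$, non-decreasing in each variable, such that for all $1<p<\infty$, if $u\in A_p(\mathcal{B})$ then $u\in RH_{\Delta(p,[u]_{A_p})}(\mathcal{B})$ with $[u]_{RH_{\Delta(p,[u]_{A_p})}}\le K(p,[u]_{A_p})$. Assume there exists $1<p_0<\infty$ such that $X(\mathcal{B},\Lambda)$ satisfies the weight invariance property for $A_{p_0}(\mathcal{B})$ and such that $\Psi_p(2\|\mathcal{M}_{\mathcal{B}}\|_{L^p,L^p})$ is finite for all $1<p<p_0$. Then $X(\mathcal{B},\Lambda)$ satisfies the $p$-power John-Nirenberg property for the interval $(0,\infty)$. Moreover, $$c_{1,p}\le 2\,\Psi_{p'}\big(2\|\mathcal{M}_{\mathcal{B}}\|_{L^{p'},L^{p'}}\big)<\infty\qquad\text{for all }1<p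<\infty.$$
   Context: Setting. $(Y,\Sigma,\mu)$ is a measure space with $\mu$ non-negative and $\sigma$-finite, and $\mathcal{B}\subset\Sigma$ is a collection of sets with $0<\mu(B)<\infty$ for all $B\in\mathcal{B}$. $L^1_{loc}(\mu)$ is the set of $\mu$-measurable $f:Y\to\mathbb{C}$ with $\int_B|f|\,d\mu<\infty$ for all $B\in\mathcal{B}$. $\mathcal{M}_{\mathcal{B}}$ is a sublinear operator mapping $L^1_{loc}(\mu)$ into non-negative $\mu$-measurable functions (it need not be a maximal function), and $\|\mathcal{M}_{\mathcal{B}}\|_{L^p,L^p}$ is its operator norm on $L^p(\mu)$. For $1<p<\infty$, $p'=p/(p-1)$. Weights. For $1<p<\infty$, a non-negative locally $\mu$-integrable function $w$ belongs to $A_p(\mathcal{B})$ if $$[w]_{A_p}=\sup_{B\in\mathcal{B}}\Big(\frac1{\mu(B)}\int_B w\,d\mu\Big)\Big(\frac1{\mu(B)}\int_B w^{-p'/p}\,d\mu\Big)^{p/p'}<\infty$$ (finiteness includes finiteness of each average, so $0<w(B)<\infty$, where $w(B)=\int_B w\,d\mu$). $A_\infty(\mathcal{B})=\bigcup_{1<p<\infty}A_p(\mathcal{B})$. A weight $w$ is in $A_1(\mathcal{B})$ if $\mathcal{M}_{\mathcal{B}}w\le Cw$ for some constant $C$; $[w]_{A_1}$ is the minimal such $C$. For $1<\delta<\infty$, $RH_\delta(\mathcal{B})$ is the set of $w\in A_\infty(\mathcal{B})$ for which there is a constant $C$ with $\big(\frac1{\mu(B)}\int_B w^\delta d\mu\big)^{1/\delta}\le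 C\,\frac1{\mu(B)}\int_B w\,d\mu$ for all $B\in\mathcal{B}$; $[w]_{RH_\delta}$ is the smallest such $C$. Oscillation spaces. $\mathfrak{F}$ is a set and $\Lambda$ assigns to each $(f,B)\in\mathfrak{F}\times\mathcal{B}$ a non-negative $\mu$-measurable function $\Lambda(f,B)$ on $Y$. For $w\in A_\infty(\mathcal{B})$ and $0<p<\infty$, put $\|f\|_{X_w^p}=\Big(\sup_{B\in\mathcal{B}}\frac1{w(B)}\int_B\Lambda(f,B)^p\,w\,d\mu\Big)^{1/p}\in[0,\infty]$ and let $X_w^p(\mathcal{B},\Lambda)=\{f\in\mathfrak{F}:\|f\|_{X_w^p}<\infty\}$. Write $X^p=X_1^p$, $X_w=X_w^1$, $X=X_1^1$. (No vector space or norm structure is assumed.) Weight invariance. $X(\mathcal{B},\Lambda)$ satisfies the weight invariance property for $\mathcal{W}\subset A_\infty(\mathcal{B})$ if for all $w,v\in\mathcal{W}$, $X_w(\mathcal{B},\Lambda)=X_v(\mathcal{B},\Lambda)$ and there is a finite constant $b_{w,v}>0$ with $\|f\|_{X_v}\le b_{w,v}\|f\|_{X_w}$ for all $f\in X_w(\mathcal{B},\Lambda)$; $b_{w,v}$ denotes the smallest such constant (set equal to $\infty$ if there is none). For $1<p<\infty$ and $t\ge1$, $$\Psi_p(t)=\sup\{b_{1,v}: v\in A_p(\mathcal{B}),\ [v]_{A_p}\le t\}\in[0,\infty].$$ $p$-power John-Nirenberg property. $X(\mathcal{B},\Lambda)$ satisfies this property for an interval $I\subset(0,\infty)$ if for any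 $p<q$ in $I$ there is a constant $C>0$ (possibly depending on $p,q$) such that $\|f\|_{X^q}\le C\|f\|_{X^p}$ for all $f\in X(\mathcal{B},\Lambda)$. The infimum of such constants is $c_{p,q}$. *)

(* Defs.v *)
From mathcomp Require Import all_boot all_order all_algebra.
From mathcomp Require Import complex.
From mathcomp Require Import all_classical all_reals all_analysis.
From mathcomp Require Import measurable_realfun.

Set Implicit Arguments.
Unset Strict Implicit.
Unset Printing Implicit Defensive.

Import Order.TTheory GRing.Theory Num.Theory.
Import numFieldNormedType.Exports.

Local Open Scope classical_set_scope.
Local Open Scope ring_scope.
Local Open Scope ereal_scope.

(* Supremum in [0, +oo]: it differs from ereal_sup only in that the supremum
   of the empty set is 0 instead of -oo. *)
Definition sup0 (R : realType) (S : set (\bar R)) : \bar R :=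
  ereal_sup ([set 0] `|` S).

Definition conj_exp (R : realType) (p : R) : R := (p / (p - 1))%R.

Section weights.
Context {d : measure_display} {Y : measurableType d} {R : realType}.
Variables (mu : {measure set Y -> \bar R}) (BB : set (set Y)).

Local Notation normc := ComplexField.Normc.normc.

Definition cmeasurable (f : Y -> R[i]) : Prop :=
  measurable_fun setT (fun y => complex.Re (f y)) /\
  measurable_fun setT (fun y => complex.Im (f y)).

Definition L1loc : set (Y -> R[i]) := [set f | cmeasurable f /\
  forall B, BB B -> \int[mu]_(y in B) (normc (f y))%:E < +oo].

Definition cLnorm (p : R) (f : Y -> R[i]) : \bar R :=
  Lnorm mu p%:E (fun y => (normc (f y))%:E).

Definition Lp (p : R) : set (Y -> R[i]) :=
  [set f | cmeasurable f /\ cLnorm p f < +oo].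

(* Only the values of M on L1loc are meaningful. *)
Definition sublinear_operator (M : (Y -> R[i]) -> Y -> \bar R) : Prop :=
  [/\ forall f, L1loc f ->
        measurable_fun setT (M f) /\ (forall y, 0 <= M f y),
      forall f g, L1loc f -> L1loc g ->
        {ae mu, forall y, M (fun z => f z + g z)%R y <= M f y + M g y} &
      forall (a : R[i]) f, L1loc f ->
        {ae mu, forall y, M (fun z => a * f z)%R y = (normc a)%:E * M f y}].

(* ||M||_{L^p,L^p}; the infimum is +oo when M is unbounded on L^p *)
Definition opnorm (M : (Y -> R[i]) -> Y -> \bar R) (p : R) : \bar R :=
  ereal_inf [set C%:E | C in [set C : R | (0 <= C)%R /\
    forall f, Lp p f -> Lnorm mu p%:E (M f) <= C%:E * cLnorm p f]].

Definition avg (B : set Y) (g : Y -> \bar R) : \bar R :=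
  (\int[mu]_(y in B) g y) / mu B.

Definition wmeas (w : Y -> R) (B : set Y) : \bar R :=
  \int[mu]_(y in B) (w y)%:E.

Definition complexify (w : Y -> R) : Y -> R[i] := fun y => ((w y)%:C)%C.

Definition nonneg_loc_integrable (w : Y -> R) : Prop :=
  (forall y, (0 <= w y)%R) /\ L1loc (complexify w).

(* w^(-s) for s > 0, with value +oo where w vanishes *)
Definition neg_pow (w : Y -> R) (s : R) : Y -> \bar R :=
  fun y => ((w y `^ s)%R%:E)^-1.

Definition Ap_prod (p : R) (w : Y -> R) (B : set Y) : \bar R :=
  avg B (fun y => (w y)%:E) *
  (avg B (neg_pow w (conj_exp p / p)%R)) `^ (p / conj_exp p).

Definition Ap_const (p : R) (w : Y -> R) : \bar R :=
  sup0 [set Ap_prod p w B | B in BB].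

(* The averages are required to be finite separately, since 0 * +oo = 0. *)
Definition Ap (p : R) : set (Y -> R) := [set w |
  [/\ nonneg_loc_integrable w,
      forall B, BB B -> avg B (fun y => (w y)%:E) < +oo /\
                        avg B (neg_pow w (conj_exp p / p)%R) < +oo &
      Ap_const p w < +oo]].

Definition Ainfty : set (Y -> R) := \bigcup_(p in [set p : R | (1 < p)%R]) Ap p.

Definition A1_bound (M : (Y -> R[i]) -> Y -> \bar R) (w : Y -> R) (C : R) : Prop :=
  (0 <= C)%R /\ {ae mu, forall y, M (complexify w) y <= C%:E * (w y)%:E}.

(* Weights in A_1 are positive almost everywhere: the zero function satisfies
   M 0 <= C * 0 but lies in no A_p. *)
Definition A1 (M : (Y -> R[i]) -> Y -> \bar R) : set (Y -> R) := [set w |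
  [/\ nonneg_loc_integrable w,
      {ae mu, forall y, (0 < w y)%R} &
      exists C : R, A1_bound M w C]].

Definition A1_const (M : (Y -> R[i]) -> Y -> \bar R) (w : Y -> R) : \bar R :=
  ereal_inf [set C%:E | C in A1_bound M w].

Definition RH_bound (delta : R) (w : Y -> R) (C : R) : Prop :=
  (0 <= C)%R /\ forall B, BB B ->
    (avg B (fun y => (w y `^ delta)%R%:E)) `^ delta^-1 <=
    C%:E * avg B (fun y => (w y)%:E).

Definition RH (delta : R) : set (Y -> R) :=
  [set w | Ainfty w /\ exists C : R, RH_bound delta w C].

Definition RH_const (delta : R) (w : Y -> R) : \bar R :=
  ereal_inf [set C%:E | C in RH_bound delta w].

Definition A1_sub_Ap (M : (Y -> R[i]) -> Y -> \bar R) : Prop :=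
  forall (w : Y -> R) (p : R), A1 M w -> (1 < p)%R ->
    Ap p w /\ Ap_const p w <= A1_const M w.

Definition Ainfty_eq_RH : Prop :=
  Ainfty = \bigcup_(delta in [set delta : R | (1 < delta)%R]) RH delta.

Definition opnorm_blowup (M : (Y -> R[i]) -> Y -> \bar R) : Prop :=
  (forall p : R, (1 < p)%R -> 0 < opnorm M p < +oo) /\
  limf_esup (opnorm M) (at_right (1 : R)%R) = +oo.

(* Delta and K are only constrained, and used, on ]1, +oo[ x [1, +oo[. *)
Definition quantitative_RH : Prop :=
  exists Delta K : R -> R -> R,
  [/\ forall p t : R, (1 < p)%R -> (1 <= t)%R ->
        (1 < Delta p t)%R /\ (1 < K p t)%R,
      forall p q t : R, (1 < p)%R -> (p <= q)%R -> (1 <= t)%R ->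
        (Delta q t <= Delta p t)%R /\ (K p t <= K q t)%R,
      forall p s t : R, (1 < p)%R -> (1 <= s)%R -> (s <= t)%R ->
        (Delta p t <= Delta p s)%R /\ (K p s <= K p t)%R &
      forall (p : R) (u : Y -> R), (1 < p)%R -> Ap p u ->
        let t := fine (Ap_const p u) in
        RH (Delta p t) u /\ RH_const (Delta p t) u <= (K p t)%:E].

Section oscillation.
Variables (F : Type) (Lam : F -> set Y -> Y -> \bar R).

Definition oscillation : Prop := forall f B, BB B ->
  measurable_fun setT (Lam f B) /\ (forall y, 0 <= Lam f B y).

Definition Xnorm (w : Y -> R) (p : R) (f : F) : \bar R :=
  (sup0 [set (\int[mu]_(y in B) ((Lam f B y) `^ p * (w y)%:E)) / wmeas w B
        | B in BB]) `^ p^-1.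

Definition Xspace (w : Y -> R) (p : R) : set F := [set f | Xnorm w p f < +oo].

Definition one : Y -> R := cst 1%R.

Definition b_bound (w v : Y -> R) (b : R) : Prop := (0 < b)%R /\
  forall f, Xspace w 1 f -> Xnorm v 1 f <= b%:E * Xnorm w 1 f.

Definition b_const (w v : Y -> R) : \bar R :=
  ereal_inf [set b%:E | b in b_bound w v].

Definition weight_invariance (W : set (Y -> R)) : Prop :=
  forall w v, W w -> W v ->
    Xspace w 1 = Xspace v 1 /\ exists b : R, b_bound w v b.

Definition Psi (p : R) (t : \bar R) : \bar R :=
  sup0 [set b_const one v | v in [set v | Ap p v /\ Ap_const p v <= t]].

Definition JN_bound (p q : R) (C : R) : Prop := (0 < C)%R /\
  forall f, Xspace one 1 f -> Xnorm one q f <= C%:E * Xnorm one p f.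

Definition power_JN (I : interval R) : Prop :=
  forall p q : R, p \in I -> q \in I -> (p < q)%R -> exists C : R, JN_bound p q C.

Definition JN_const (p q : R) : \bar R :=
  ereal_inf [set C%:E | C in JN_bound p q].

End oscillation.
End weights.

(* Main.v *)
Require Import Defs.
From mathcomp Require Import all_boot all_order all_algebra.
From mathcomp Require Import complex.
From mathcomp Require Import all_classical all_reals all_analysis.
From mathcomp Require Import measurable_realfun.
From mathcomp Require Import ring lra.

Set Implicit Arguments.
Unset Strict Implicit.
Unset Printing Implicit Defensive.

Import Order.TTheory GRing.Theory Num.Theory.
Import numFieldNormedType.Exports.

Local Open Scope classical_set_scope.
Local Open Scope ring_scope.
Local Open Scope ereal_scope.

(** Everything rests on the estimate
    [||f||_{X^p} <= 2 Psi_{p'}(2 ||M||_{p'}) ||f||_X] for [1 < p]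
    ([Xnorm_le_dual_Psi]).  By duality the [L^p] norm of the oscillation on a
    set [B] is governed by its integrals against functions [g] in [L^{p'}].
    The Rubio de Francia series of [g] is a majorant [w] of [g] of norm at most
    [2 ||g||_{p'}] with [M w <= 2 ||M||_{p'} w] almost everywhere
    ([rubio_de_francia]).  So [w] is an A_1 weight, hence an A_{p'} weight of
    characteristic at most [2 ||M||_{p'}], and the definition of [Psi] bounds
    the integral of the oscillation against [w] by [||f||_X] times the mass
    [w(B)], which Hoelder's inequality turns back into [||g||_{p'}].  The
    function [g] has to be positive almost everywhere for [w] to be a weight;
    a small multiple of a positive function in [L^{p'}], which exists because
    the measure is sigma-finite, takes care of that.

    The hypothesis makes this bound finite when [p'] is below [p0], that is for
    all large [p].  The norms [||f||_{X^p}], built from averages, increase with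
    [p], so every one of them is controlled by [||f||_X].  The quantitative
    reverse Hoelder inequality then shows that [Psi_q(t)] is finite for all [q]
    and [t] ([Psi_lty]), so that the bound above is finite for every [p].

    An exponent [p < 1] is compared with [1] by interpolating [1] between [p]
    and [2 - p] and dividing out a power of the finite number [||f||_X]
    ([JN_bound_lt1]); the general pair of exponents follows by passing through
    [1]. *)

(** * Powers of extended real numbers *)

Section extended_powers.
Context {R : realType}.
Implicit Types (x y : \bar R) (r s : R).

Lemma poweR_le r x y : (0 <= r)%R -> 0 <= x -> x <= y -> x `^ r <= y `^ r.
Proof.
move=> r0 x0 xy; apply: gt0_ler_poweR => //; rewrite in_itv/= leey ?x0 ?andbT//.
exact: le_trans xy.
Qed.

Lemma poweRK r x : r != 0%R -> 0 <= x -> (x `^ r) `^ r^-1 = x.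
Proof. by move=> r0 x0; rewrite -poweRrM mulfV// poweRe1. Qed.

Lemma poweRVK r x : r != 0%R -> 0 <= x -> (x `^ r^-1) `^ r = x.
Proof. by move=> r0 x0; rewrite -poweRrM mulVf// poweRe1. Qed.

Lemma poweRV_le r x y : (0 < r)%R -> 0 <= x -> 0 <= y ->
  (x `^ r^-1 <= y) = (x <= y `^ r).
Proof.
move=> r0 x0 y0; apply/idP/idP => h.
  by rewrite -(@poweRVK r x) ?gt_eqF// poweR_le ?poweR_ge0// ltW.
by rewrite -(@poweRK r y) ?gt_eqF// poweR_le// invr_ge0 ltW.
Qed.

End extended_powers.

(** * Lebesgue norms of non-negative extended real functions *)

Section nonnegative_integrals.
Context d (T : measurableType d) (R : realType).
Variable mu : {measure set T -> \bar R}.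
Implicit Types (D : set T) (f g : T -> \bar R) (p q : R).

Lemma measurable_fun_poweR D f p :
  measurable_fun D f -> measurable_fun D (fun x => f x `^ p).
Proof. exact: (measurableT_comp (measurable_poweR p)). Qed.

Lemma ae_fin_num_integral_poweR D f p : measurable D -> measurable_fun D f ->
    (forall x, D x -> 0 <= f x) -> (0 < p)%R ->
  \int[mu]_(x in D) (f x `^ p) < +oo ->
  {ae mu, forall x, D x -> f x \is a fin_num}.
Proof.
move=> mD mf f0 p0 fp.
have ifp : mu.-integrable D (fun x => f x `^ p).
  apply/integrableP; split; first exact: measurable_fun_poweR.
  by under eq_integral do rewrite gee0_abs ?poweR_ge0//.
apply: filterS (integrable_ae mD ifp) => x /[swap] Dx /(_ Dx).
rewrite !ge0_fin_numE ?poweR_ge0 ?f0// => /lty_poweRy; apply.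
by rewrite gt_eqF.
Qed.

Lemma ae_eq0_integral_poweR D f p : measurable D -> measurable_fun D f ->
    (forall x, D x -> 0 <= f x) -> (0 < p)%R ->
  \int[mu]_(x in D) (f x `^ p) = 0 ->
  {ae mu, forall x, D x -> f x = 0}.
Proof.
move=> mD mf f0 p0 fp.
have : \int[mu]_(x in D) `|f x `^ p| = 0.
  by under eq_integral do rewrite gee0_abs ?poweR_ge0//.
move/(ae_eq_integral_abs mu mD (measurable_fun_poweR p mf)).
by apply: filterS => x /= h Dx; move: (h Dx); apply: poweR_eq0_eq0; exact: f0.
Qed.

Lemma integral_eq0_ae D f : measurable D -> measurable_fun D f ->
    (forall x, D x -> 0 <= f x) ->
  {ae mu, forall x, D x -> f x = 0} -> \int[mu]_(x in D) f x = 0.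
Proof.
move=> mD mf f0 ae0; rewrite (ge0_ae_eq_integral mD mf (measurable_cst 0))//.
by rewrite integral0.
Qed.

Let hoelder_EFin D (f g : T -> R) p q : measurable D ->
    measurable_fun D f -> measurable_fun D g ->
    (forall x, D x -> 0 <= f x)%R -> (forall x, D x -> 0 <= g x)%R ->
    (0 < p)%R -> (0 < q)%R -> (p^-1 + q^-1 = 1)%R ->
  \int[mu]_(x in D) ((f x)%:E * (g x)%:E) <=
  (\int[mu]_(x in D) ((f x)%:E `^ p)) `^ p^-1 *
  (\int[mu]_(x in D) ((g x)%:E `^ q)) `^ q^-1.
Proof.
move=> mD mf mg f0 g0 p0 q0 pq.
have := @hoelder _ _ _ mu (f \_ D) (g \_ D) p q
  ((measurable_restrictT f mD).1 mf) ((measurable_restrictT g mD).1 mg) p0 q0 pq.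
have restr (h : T -> R) (r : R) : (0 < r)%R -> (forall x, D x -> 0 <= h x)%R ->
    \int[mu]_x (`|(EFin \o (h \_ D)) x| `^ r) =
    \int[mu]_(x in D) ((h x)%:E `^ r).
  move=> r0 h0; rewrite [RHS]integral_mkcond; apply: eq_integral => x _ /=.
  rewrite !patchE; case: ifPn; first by rewrite inE => Dx; rewrite ger0_norm ?h0.
  by rewrite normr0 powR0 ?gt_eqF.
rewrite Lnorm1 unlock !restr// => /(le_trans _); apply.
rewrite [leLHS]integral_mkcond le_eqVlt; apply/orP; left; apply/eqP.
apply: eq_integral => x _; rewrite /= !patchE.
case: ifPn; last by rewrite mul0r normr0.
by rewrite inE => Dx; rewrite ger0_norm// mulr_ge0 ?f0 ?g0.
Qed.

(** If one of the norms is zero the corresponding function vanishes almost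
    everywhere; if both are finite and positive the two functions agree almost
    everywhere with real-valued ones, for which the inequality is classical. *)
Lemma ge0_hoelder D f g p q : measurable D ->
    measurable_fun D f -> measurable_fun D g ->
    (forall x, D x -> 0 <= f x) -> (forall x, D x -> 0 <= g x) ->
    (0 < p)%R -> (0 < q)%R -> (p^-1 + q^-1 = 1)%R ->
  \int[mu]_(x in D) (f x * g x) <=
  (\int[mu]_(x in D) (f x `^ p)) `^ p^-1 *
  (\int[mu]_(x in D) (g x `^ q)) `^ q^-1.
Proof.
move=> mD mf mg f0 g0 p0 q0 pq.
have mfg : measurable_fun D (fun x => f x * g x) by exact: emeasurable_funM.
have fg0 x : D x -> 0 <= f x * g x by move=> Dx; rewrite mule_ge0 ?f0 ?g0.
have If0 : 0 <= \int[mu]_(x in D) (f x `^ p).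
  by apply: integral_ge0 => x _; exact: poweR_ge0.
have Ig0 : 0 <= \int[mu]_(x in D) (g x `^ q).
  by apply: integral_ge0 => x _; exact: poweR_ge0.
have [If|If] := eqVneq (\int[mu]_(x in D) (f x `^ p)) 0.
  rewrite integral_eq0_ae ?mule_ge0 ?poweR_ge0//.
  apply: filterS (ae_eq0_integral_poweR mD mf f0 p0 If) => x h Dx.
  by rewrite h// mul0e.
have [Ig|Ig] := eqVneq (\int[mu]_(x in D) (g x `^ q)) 0.
  rewrite integral_eq0_ae ?mule_ge0 ?poweR_ge0//.
  apply: filterS (ae_eq0_integral_poweR mD mg g0 q0 Ig) => x h Dx.
  by rewrite h// mule0.
have [Ify|Ify] := eqVneq (\int[mu]_(x in D) (f x `^ p)) +oo.
  rewrite Ify poweRyr ?invr_neq0 ?gt_eqF// gt0_mulye ?leey// poweR_gt0//.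
  by rewrite lt0e Ig.
have [Igy|Igy] := eqVneq (\int[mu]_(x in D) (g x `^ q)) +oo.
  rewrite Igy poweRyr ?invr_neq0 ?gt_eqF// gt0_muley ?leey// poweR_gt0//.
  by rewrite lt0e If.
have fne (h : T -> \bar R) (r : R) : measurable_fun D h ->
    (forall x, D x -> 0 <= h x) -> (0 < r)%R ->
    \int[mu]_(x in D) (h x `^ r) != +oo ->
    {ae mu, forall x, D x -> (fine (h x))%:E = h x}.
  move=> mh h0 r0; rewrite -ltey => hy.
  apply: filterS (ae_fin_num_integral_poweR mD mh h0 r0 hy) => x hfin Dx.
  by rewrite fineK ?hfin.
have finf := fne f p mf f0 p0 Ify.
have fing := fne g q mg g0 q0 Igy.
have mfine (h : T -> \bar R) : measurable_fun D h -> measurable_fun D (fine \o h).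
  exact: measurableT_comp.
have ffine (h : T -> \bar R) (r : R) : measurable_fun D h ->
    {ae mu, forall x, D x -> (fine (h x))%:E = h x} ->
    \int[mu]_(x in D) ((fine (h x))%:E `^ r) = \int[mu]_(x in D) (h x `^ r).
  move=> mh hfin; apply: ge0_ae_eq_integral => //.
  - by apply/measurable_fun_poweR/measurable_EFinP; exact: mfine.
  - exact: measurable_fun_poweR.
  - by move=> x _; exact: poweR_ge0.
  - by move=> x _; exact: poweR_ge0.
  - by apply: filterS hfin => x hx Dx; rewrite hx.
have h := hoelder_EFin mD (mfine _ mf) (mfine _ mg)
  (fun x Dx => fine_ge0 (f0 x Dx)) (fun x Dx => fine_ge0 (g0 x Dx)) p0 q0 pq.
rewrite (@ge0_ae_eq_integral _ _ _ mu D _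
  (fun x => (fine (f x))%:E * (fine (g x))%:E))//; last 3 first.
- by apply: emeasurable_funM; apply/measurable_EFinP; exact: mfine.
- by move=> x Dx; rewrite mule_ge0 ?lee_fin ?fine_ge0 ?f0 ?g0.
- by apply: filterS2 finf fing => x fx gx Dx; rewrite fx// gx.
by move: h; rewrite (ffine f)// (ffine g).
Qed.

(** Monotone convergence without a limit in the statement.  The hypothesis on
    upper bounds says that [f] lies below the supremum of the sequence; taking
    roots of upper bounds carries this over to the powers, so that continuity
    of the power function is never invoked. *)
Lemma ge0_integral_poweR_sup D (S : nat -> T -> \bar R) f p c : measurable D ->
    (forall n, measurable_fun D (S n)) -> (forall n x, D x -> 0 <= S n x) ->
    (forall x, D x -> {homo S^~ x : n m / (n <= m)%N >-> n <= m}) ->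
    measurable_fun D f -> (forall x, D x -> 0 <= f x) ->
    (forall x, D x -> forall y, (forall n, S n x <= y) -> f x <= y) ->
    (0 < p)%R -> (forall n, \int[mu]_(x in D) (S n x `^ p) <= c) ->
  \int[mu]_(x in D) (f x `^ p) <= c.
Proof.
move=> mD mS S0 ndS mf f0 Sf p0 Sc.
pose Sp n x := S n x `^ p.
have mSp n : measurable_fun D (Sp n) by exact: measurable_fun_poweR.
have Sp0 n x : D x -> 0 <= Sp n x by move=> _; exact: poweR_ge0.
have ndSp x : D x -> {homo Sp^~ x : n m / (n <= m)%N >-> n <= m}.
  by move=> Dx n m nm; apply: poweR_le; [exact: ltW|exact: S0|exact: ndS].
have cvgSp x : D x -> cvgn (Sp^~ x).
  by move=> Dx; apply: ereal_nondecreasing_is_cvgn; exact: ndSp.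
have := monotone_convergence mu mD mSp Sp0 ndSp => mcv.
apply: (@le_trans _ _ (\int[mu]_(x in D) limn (Sp^~ x))).
  apply: ge0_le_integral => //.
  - by move=> x _; exact: poweR_ge0.
  - exact: measurable_fun_poweR.
  - by apply: (emeasurable_fun_cvg Sp) => // x Dx; exact: cvgSp.
  move=> x Dx; have lim_ge n : Sp n x <= limn (Sp^~ x).
    apply: lime_ge; first exact: cvgSp.
    by exists n => // m /= nm; exact: ndSp.
  have lim0 : 0 <= limn (Sp^~ x) by apply: le_trans (lim_ge 0%N); exact: Sp0.
  rewrite -[p in leLHS]invrK poweRV_le ?invr_gt0 ?f0//.
  apply: Sf => // n; rewrite -poweRV_le ?invr_gt0 ?S0// invrK.
  exact: lim_ge.
rewrite mcv; apply: lime_le; last exact: nearW.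
apply: ereal_nondecreasing_is_cvgn => n m nm.
apply: ge0_le_integral => // x Dx; [exact: Sp0|exact: ndSp].
Qed.

Lemma ge0_LnormE f p : (forall x, 0 <= f x) ->
  Lnorm mu p%:E f = (\int[mu]_x (f x `^ p)) `^ p^-1.
Proof.
move=> f0; rewrite unlock; congr (_ `^ _).
by apply: eq_integral => x _; rewrite gee0_abs.
Qed.

Lemma ge0_Lnorm_ae_le f g p : (0 < p)%R ->
    measurable_fun setT f -> measurable_fun setT g ->
    {ae mu, forall x, `|f x| <= `|g x|} ->
  Lnorm mu p%:E f <= Lnorm mu p%:E g.
Proof.
move=> p0 mf mg fg; rewrite unlock; apply: poweR_le.
- by rewrite invr_ge0 ltW.
- by apply: integral_ge0 => x _; exact: poweR_ge0.
apply: ae_ge0_le_integral => //.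
- by move=> x _; exact: poweR_ge0.
- by apply: measurable_fun_poweR; exact: measurableT_comp.
- by move=> x _; exact: poweR_ge0.
- by apply: measurable_fun_poweR; exact: measurableT_comp.
by apply: filterS fg => x fgx _; apply: poweR_le => //; exact: ltW.
Qed.

Lemma Lnorm_sum_le (u : nat -> T -> R) (a : nat -> \bar R) p n : (1 <= p)%R ->
    (forall k, measurable_fun setT (u k)) ->
    (forall k, Lnorm mu p%:E (EFin \o u k) <= a k) ->
  Lnorm mu p%:E (EFin \o (fun x => \sum_(k < n) u k x)%R) <=
  \sum_(k < n) a k.
Proof.
move=> p1 mu_ ua; elim: n => [|n ih].
  rewrite big_ord0 (_ : _ \o _ = cst 0); last first.
    by apply/funext => x /=; rewrite big_ord0.
  by rewrite Lnorm0// eqe gt_eqF// (lt_le_trans ltr01).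
rewrite big_ord_recr/=; apply: le_trans (leeD ih (ua n)).
rewrite (_ : (fun x => _) = (fun x => \sum_(k < n) u k x)%R \+ u n)%R; last first.
  by apply/funext => x; rewrite big_ord_recr.
by apply: minkowski_EFin => //; exact: measurable_sum.
Qed.

(** Minkowski's inequality for series of non-negative functions: the partial
    sums increase to the sum, so monotone convergence applies. *)
Lemma Lnorm_nneseries_le (u : nat -> T -> R) (a : nat -> \bar R) p :
    (1 <= p)%R ->
    (forall k, measurable_fun setT (u k)) -> (forall k x, 0 <= u k x)%R ->
    (forall k, Lnorm mu p%:E (EFin \o u k) <= a k) ->
  Lnorm mu p%:E (fun x => \sum_(k <oo) (u k x)%:E) <= \sum_(k <oo) a k.
Proof.
move=> p1 mu_ u0 ua.
have p0 : (0 < p)%R by exact: lt_le_trans p1.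
have a0 k : 0 <= a k by apply: le_trans (ua k); exact: Lnorm_ge0.
have sa0 : 0 <= \sum_(k <oo) a k by exact: nneseries_ge0.
have s0 x : 0 <= \sum_(k <oo) (u k x)%:E.
  by apply: nneseries_ge0 => k _ _; rewrite lee_fin.
rewrite ge0_LnormE// poweRV_le ?integral_ge0// => [|x _]; last exact: poweR_ge0.
pose S n x := \sum_(k < n) (u k x)%:E.
apply: (@ge0_integral_poweR_sup setT S) => //.
- by move=> n; apply: emeasurable_sum => k; apply/measurable_EFinP.
- by move=> n x _; apply: sume_ge0 => k _; rewrite lee_fin.
- move=> x _ n m nm; rewrite /S.
  rewrite -2!(big_mkord xpredT (fun k => (u k x)%:E)).
  by apply: lee_sum_nneg_natr => // k _ _; rewrite lee_fin.
- apply: ge0_emeasurable_sum => // k; first by move=> x _ _; rewrite lee_fin.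
  by move=> _; apply/measurable_EFinP.
- move=> x _ y Sy; apply: lime_le.
    by apply: is_cvg_nneseries => k _ _; rewrite lee_fin.
  by apply: nearW => n; rewrite /= big_mkord; exact: Sy.
move=> n; have := Lnorm_sum_le n p1 mu_ ua.
rewrite ge0_LnormE => [|x]; last by rewrite lee_fin sumr_ge0.
rewrite poweRV_le ?sume_ge0// ?integral_ge0// => [|x _]; last exact: poweR_ge0.
have SE x : S n x = (\sum_(k < n) u k x)%:E by rewrite /S sumEFin.
rewrite (eq_integral (fun x => (S n x) `^ p)); last by move=> x _; rewrite SE.
move=> /le_trans; apply; apply: poweR_le; [exact: ltW|exact: sume_ge0|].
rewrite -(big_mkord xpredT a); exact: nneseries_lim_ge.
Qed.

(** Hoelder's inequality against the constant one: the normalised norms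
    increase with the exponent. *)
Lemma integral_poweR_exponent_le D f s r c : measurable D ->
    measurable_fun D f -> (forall x, D x -> 0 <= f x) ->
    (0 < s)%R -> (s <= r)%R -> 0 <= c ->
    \int[mu]_(x in D) (f x `^ r) <= c `^ r * mu D ->
  \int[mu]_(x in D) (f x `^ s) <= c `^ s * mu D.
Proof.
move=> mD mf f0 s0; rewrite le_eqVlt => /predU1P[<-//|sr] c0 fr.
have r0 : (0 < r)%R by exact: lt_trans sr.
have sr1 : (s / r < 1)%R by rewrite ltr_pdivrMr ?mul1r.
have sr0 : (0 < s / r)%R by rewrite divr_gt0.
have := @ge0_hoelder D (fun x => f x `^ s) (cst 1) (r / s) (1 - s / r)^-1 mD
  (measurable_fun_poweR s mf) (measurable_cst _)
  (fun x _ => poweR_ge0 _ _) (fun _ _ => lee01).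
rewrite divr_gt0// invr_gt0 subr_gt0 sr1 invrK invf_div addrC subrK => /(_ erefl erefl erefl).
under eq_integral do rewrite mule1.
move=> /le_trans; apply.
under eq_integral do rewrite -poweRrM mulrCA divff ?gt_eqF// mulr1.
under [X in _ * X `^ _]eq_integral do rewrite poweR1r.
rewrite integral_cst// mul1e.
have -> : c `^ s * mu D = (c `^ r * mu D) `^ (s / r) * mu D `^ (1 - s / r).
  rewrite poweRM ?poweR_ge0// -poweRrM mulrCA divff ?gt_eqF// mulr1 -muleA.
  rewrite -poweRD ?subrKC ?poweRe1//.
  by rewrite add_neq0_poweRD_def// subrKC oner_neq0.
rewrite lee_pmul ?poweR_ge0// poweR_le//; first exact: ltW.
by apply: integral_ge0 => x _; exact: poweR_ge0.
Qed.
End nonnegative_integrals.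

(** * The dual description of the Lebesgue norm *)

Section converse_hoelder.
Context d (T : measurableType d) (R : realType).
Variable mu : {measure set T -> \bar R}.

Let trunc (f : T -> \bar R) (n : nat) (x : T) : \bar R := mine (f x) n%:R%:E.

Lemma trunc_fin_num f n x : 0 <= f x -> trunc f n x \is a fin_num.
Proof.
move=> f0; rewrite ge0_fin_numE; last by rewrite le_min f0 lee_fin/=.
by rewrite gt_min ltry orbT.
Qed.

(** The extremal test function in Hoelder's inequality is the power [p - 1] of
    [f]; truncating [f] first makes it bounded, hence admissible. *)
Lemma converse_hoelder (D : set T) (f : T -> \bar R) (p q : R) (c : \bar R) :
    measurable D -> mu D < +oo ->
    measurable_fun D f -> (forall x, D x -> 0 <= f x) ->
    (0 < p)%R -> (0 < q)%R -> (p^-1 + q^-1 = 1)%R -> 0 <= c ->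
    (forall g : T -> R, measurable_fun setT g -> (forall x, 0 <= g x)%R ->
       Lnorm mu q%:E (EFin \o g) < +oo ->
       \int[mu]_(x in D) (f x * (g x)%:E) <= c * Lnorm mu q%:E (EFin \o g)) ->
  \int[mu]_(x in D) (f x `^ p) <= c `^ p.
Proof.
move=> mD muD mf f0 p0 q0 pq c0 H.
have qE : ((p - 1) * q = p)%R.
  have pN0 : p != 0%R by rewrite gt_eqF.
  have qN0 : q != 0%R by rewrite gt_eqF.
  have h : (p * q * (p^-1 + q^-1) = p * q)%R by rewrite pq mulr1.
  have h' : (p * q * (p^-1 + q^-1) = q + p)%R by field; rewrite pN0 qN0.
  by rewrite mulrBl mul1r -h h' addrAC subrr add0r.
have p1 : (0 < p - 1)%R.
  have : (0 < (p - 1) * q)%R by rewrite qE.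
  by rewrite pmulr_lgt0.
pose S n x := trunc f n x.
have S0 n x : D x -> 0 <= S n x by move=> Dx; rewrite le_min f0//= lee_fin.
have Sfin n x : D x -> S n x \is a fin_num by move=> /f0; exact: trunc_fin_num.
have mS n : measurable_fun D (S n) by apply: measurable_mine.
apply: (@ge0_integral_poweR_sup _ _ _ mu D S f p) => //.
- move=> x Dx n m nm; rewrite /S /trunc le_min ge_min lexx/= ge_min.
  by rewrite lee_fin ler_nat nm orbT.
- move=> x Dx y Sy; have fx0 := f0 x Dx.
  have [fy|fy] := eqVneq (f x) +oo.
    rewrite fy leye_eq; apply/eqP/eqyP => r r0.
    apply: le_trans (Sy (Num.truncn r).+1); rewrite /S /trunc fy minye lee_fin.
    by rewrite ltW// truncnS_gt.
  have fxfin : f x \is a fin_num by rewrite ge0_fin_numE// ltey.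
  apply: le_trans (Sy (Num.truncn (fine (f x))).+1).
  rewrite /S /trunc le_min lexx/= -(fineK fxfin) lee_fin.
  by rewrite ltW// truncnS_gt.
move=> n.
pose g := (fun x => (fine (S n x) `^ (p - 1))%R) \_ D.
have g0 x : (0 <= g x)%R by rewrite /g patchE; case: ifPn => //; rewrite powR_ge0.
have mg : measurable_fun setT g.
  apply/(measurable_restrictT _ mD).1.
  apply: (@measurableT_comp _ _ _ _ _ _ (@powR R ^~ (p - 1)%R)) => //.
  exact: measurableT_comp.
have gE x : D x -> (g x)%:E = S n x `^ (p - 1).
  by move=> Dx; rewrite /g patchE mem_set// -[in RHS](fineK (Sfin n x Dx)).
pose I := \int[mu]_(x in D) (S n x `^ p).
have I0 : 0 <= I by apply: integral_ge0 => x _; exact: poweR_ge0.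
have Iy : I < +oo.
  apply: (@le_lt_trans _ _ (\int[mu]_(x in D) (cst (n%:R%:E `^ p) x))).
    apply: ge0_le_integral => //.
    - by move=> x _; exact: poweR_ge0.
    - exact: measurable_fun_poweR.
    - move=> x Dx; apply: poweR_le; [exact: ltW|exact: S0|].
      by rewrite ge_min lexx orbT.
  by rewrite integral_cst// lte_mul_pinfty// ?poweR_ge0.
have NgE : Lnorm mu q%:E (EFin \o g) = I `^ q^-1.
  rewrite ge0_LnormE// /I [in RHS]integral_mkcond; congr (_ `^ _).
  apply: eq_integral => x _; rewrite /= patchE /g patchE; case: ifPn.
    rewrite inE => Dx; rewrite -powRrM qE -poweR_EFin fineK//; exact: Sfin.
  by rewrite powR0// gt_eqF.
have IN : I <= c * I `^ q^-1.
  rewrite -NgE; apply: le_trans (H g mg g0 _); last first.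
    by rewrite NgE; exact: poweR_lty.
  apply: ge0_le_integral => //.
  - by move=> x _; exact: poweR_ge0.
  - exact: measurable_fun_poweR.
  - apply: emeasurable_funM => //; apply/measurable_EFinP.
    exact: measurable_funTS.
  - move=> x Dx; rewrite gE// -[X in _ `^ X](subrK 1%R p).
    have pD : (p - 1 + 1 != 0)%R by rewrite subrK gt_eqF.
    rewrite (@poweRD _ _ (p - 1) 1) ?add_neq0_poweRD_def// poweRe1 ?S0// muleC.
    by rewrite lee_wpmul2r ?poweR_ge0// ge_min lexx.
rewrite -/I.
have [->|IN0] := eqVneq I 0; first exact: poweR_ge0.
have Igt0 : 0 < I by rewrite lt0e IN0.
rewrite -poweRV_le//.
have IE : I = I `^ p^-1 * I `^ q^-1.
  by rewrite -poweRD ?pq ?poweRe1// add_neq0_poweRD_def// pq oner_neq0.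
move: IN; rewrite {1}IE lee_pmul2r ?poweR_gt0//.
by rewrite fin_num_poweR// ge0_fin_numE.
Qed.

End converse_hoelder.

(** * Infima of constants and real functions as complex ones *)

Section best_constants.
Context {R : realType}.
Implicit Types (S : set R) (x : \bar R).

(** This lets the operator norm and the constants [b_{w,v}], both defined as
    infima, be used as if they were attained. *)
Lemma le_ereal_infM S x (y : R) : (forall C, S C -> 0 <= C)%R ->
    (0 <= y)%R -> ereal_inf [set C%:E | C in S] < +oo ->
    (forall C, S C -> x <= C%:E * y%:E) ->
  x <= ereal_inf [set C%:E | C in S] * y%:E.
Proof.
move=> S0 y0 infy H.
have inf0 : 0 <= ereal_inf [set C%:E | C in S].
  by apply: le_ereal_inf_tmp => _ [C SC <-]; rewrite lee_fin S0.
have inffin : ereal_inf [set C%:E | C in S] \is a fin_num.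
  by rewrite ge0_fin_numE.
apply/lee_addgt0Pr => e e0.
(* [y] may vanish, so the slack on the constant is [e / (y + 1)] *)
have y1 : (0 < y + 1)%R by rewrite ltr_wpDl.
have [_ [C SC <-] Ce] := @lb_ereal_inf_adherent _ _ _ (divr_gt0 e0 y1) inffin.
apply: le_trans (H C SC) _; rewrite -(fineK inffin) in Ce *.
rewrite -!EFinM -!EFinD lee_fin lte_fin in Ce *.
apply: le_trans (ler_wpM2r y0 (ltW Ce)) _; rewrite mulrDl lerD2l.
rewrite mulrAC ler_pdivrMr// ler_pM2l// lerDl//.
Qed.

End best_constants.

Section real_valued_functions.
Context d (Y : measurableType d) (R : realType).
Variable mu : {measure set Y -> \bar R}.
Implicit Types (w : Y -> R) (p : R).

Lemma normc_complexify w y :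
  ComplexField.Normc.normc (complexify w y) = `|w y|%R.
Proof. by rewrite /= expr0n/= addr0 sqrtr_sqr. Qed.

Lemma cmeasurable_complexify w :
  cmeasurable (complexify w) <-> measurable_fun setT w.
Proof. by split=> [[]//|mw]; split => //; exact: measurable_cst. Qed.

Lemma cLnorm_complexify p w :
  cLnorm mu p (complexify w) = Lnorm mu p%:E (EFin \o w).
Proof.
rewrite /cLnorm -[RHS]Lnorm_abse; apply: eq_Lnorm => y.
by rewrite normc_complexify.
Qed.

Lemma Lp_complexify p w : measurable_fun setT w ->
  Lnorm mu p%:E (EFin \o w) < +oo -> Lp mu p (complexify w).
Proof.
by move=> mw wy; split; rewrite ?cLnorm_complexify//; exact/cmeasurable_complexify.
Qed.

Lemma LnormZ_EFin p (c : R) w : (0 < p)%R -> (0 <= c)%R ->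
    measurable_fun setT w ->
  Lnorm mu p%:E (EFin \o (fun y => c * w y)%R) =
  c%:E * Lnorm mu p%:E (EFin \o w).
Proof.
move=> p0 c0 mw; rewrite unlock.
under eq_integral do rewrite /= normrM (ger0_norm c0) powRM// EFinM.
have mwp : measurable_fun setT (fun y => (`|w y| `^ p)%R%:E).
  apply/measurable_EFinP.
  apply: (@measurableT_comp _ _ _ _ _ _ (@powR R ^~ p)%R) => //.
  exact: measurableT_comp.
rewrite (ge0_integralZl_EFin mu measurableT _ mwp) ?powR_ge0//.
rewrite poweRM ?lee_fin ?powR_ge0//; last first.
  by apply: integral_ge0 => y _; rewrite lee_fin powR_ge0.
by rewrite -poweR_EFin poweRK ?gt_eqF.
Qed.

Lemma integral_le_Lnorm (B : set Y) w p q : measurable B ->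
    measurable_fun setT w -> (forall y, 0 <= w y)%R ->
    (0 < p)%R -> (0 < q)%R -> (p^-1 + q^-1 = 1)%R ->
  \int[mu]_(y in B) (w y)%:E <= Lnorm mu p%:E (EFin \o w) * mu B `^ q^-1.
Proof.
move=> mB mw w0 p0 q0 pq.
have mEw D : measurable_fun D (EFin \o w).
  by apply/measurable_EFinP; exact: measurable_funTS.
have := @ge0_hoelder _ _ _ mu B (EFin \o w) (cst 1) p q mB (mEw B)
  (measurable_cst _) (fun y _ => w0 y) (fun _ _ => lee01) p0 q0 pq.
under eq_integral do rewrite mule1.
move=> /le_trans; apply.
under [X in _ * X `^ _]eq_integral do rewrite poweR1r.
rewrite integral_cst// mul1e ge0_LnormE// lee_wpmul2r ?poweR_ge0//.
apply: poweR_le; first by rewrite invr_ge0 ltW.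
  by apply: integral_ge0 => y _; exact: poweR_ge0.
apply: ge0_subset_integral => //; last by move=> y _; exact: poweR_ge0.
exact: measurable_fun_poweR.
Qed.

Lemma L1loc_complexify (BB : set (set Y)) w p q :
    (forall B, BB B -> measurable B) -> (forall B, BB B -> 0 < mu B < +oo) ->
    measurable_fun setT w ->
    (0 < p)%R -> (0 < q)%R -> (p^-1 + q^-1 = 1)%R ->
    Lnorm mu p%:E (EFin \o w) < +oo ->
  L1loc mu BB (complexify w).
Proof.
move=> BBm BBfin mw p0 q0 pq wy; split; first exact/cmeasurable_complexify.
move=> B BBB; under eq_integral do rewrite normc_complexify.
have mnw : measurable_fun setT (fun y => `|w y|%R) by exact: measurableT_comp.
have := integral_le_Lnorm (BBm B BBB) mnw (fun y => normr_ge0 _) p0 q0 pq.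
move=> /le_lt_trans; apply.
have -> : EFin \o (fun y => `|w y|)%R = abse \o (EFin \o w) by [].
rewrite Lnorm_abse lte_mul_pinfty ?Lnorm_ge0// ?ge0_fin_numE ?Lnorm_ge0//.
by apply: poweR_lty; have /andP[] := BBfin B BBB.
Qed.

End real_valued_functions.

(** * The Rubio de Francia algorithm *)

Section rubio_de_francia.
Context d (Y : measurableType d) (R : realType).
Variables (mu : {measure set Y -> \bar R}) (BB : set (set Y)).
Hypothesis BB_meas : forall B, BB B -> measurable B.
Hypothesis BB_fin : forall B, BB B -> 0 < mu B < +oo.
Variable M : (Y -> R[i]) -> Y -> \bar R.
Hypothesis M_sub : sublinear_operator mu BB M.

Lemma le_opnorm p (f : Y -> R[i]) : opnorm mu M p < +oo -> Lp mu p f ->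
  Lnorm mu p%:E (M f) <= opnorm mu M p * cLnorm mu p f.
Proof.
move=> My Lf.
have ffin : cLnorm mu p f \is a fin_num.
  by rewrite ge0_fin_numE ?Lnorm_ge0//; case: Lf.
rewrite -(fineK ffin); apply: le_ereal_infM => //.
- by move=> C [].
- by rewrite fine_ge0// Lnorm_ge0.
- by move=> C [_ HC]; rewrite (fineK ffin); exact: HC.
Qed.

Variables (p q A : R).
Hypotheses (p1 : (1 < p)%R) (q0 : (0 < q)%R) (pq : (p^-1 + q^-1 = 1)%R).
Hypothesis opnormE : opnorm mu M p = A%:E.
Hypothesis A0 : (0 < A)%R.

Let p0 : (0 < p)%R. Proof. exact: lt_trans p1. Qed.

Let finite_norm_on (w : Y -> R) :=
  measurable_fun setT w /\ Lnorm mu p%:E (EFin \o w) < +oo.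

Let L1loc_fn w : finite_norm_on w -> L1loc mu BB (complexify w).
Proof. by move=> [mw wy]; exact: (L1loc_complexify BB_meas BB_fin mw p0 q0 pq wy). Qed.

Let measurable_M w : finite_norm_on w -> measurable_fun setT (M (complexify w)).
Proof. by move=> /L1loc_fn Lw; have [/(_ _ Lw)[]] := M_sub. Qed.

Let M_ge0 w y : finite_norm_on w -> 0 <= M (complexify w) y.
Proof. by move=> /L1loc_fn Lw; have [/(_ _ Lw)[]] := M_sub. Qed.

Let LnormM_le w : finite_norm_on w ->
  Lnorm mu p%:E (M (complexify w)) <= A%:E * Lnorm mu p%:E (EFin \o w).
Proof.
move=> [mw wy]; have := @le_opnorm p (complexify w).
rewrite opnormE ltry => /(_ erefl); rewrite cLnorm_complexify; apply.
exact: Lp_complexify.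
Qed.

Let M_fin w : finite_norm_on w ->
  {ae mu, forall y, M (complexify w) y \is a fin_num}.
Proof.
move=> Fw.
have : Lnorm mu p%:E (M (complexify w)) < +oo.
  apply: le_lt_trans (LnormM_le Fw) _; rewrite lte_mul_pinfty ?lee_fin ?ltW//.
  by case: Fw.
rewrite ge0_LnormE => [/lty_poweRy h|y]; last exact: M_ge0.
have := @ae_fin_num_integral_poweR _ _ _ mu setT (M (complexify w)) p measurableT
  (measurable_M Fw) (fun y _ => M_ge0 y Fw) p0 (h _).
rewrite invr_neq0 ?gt_eqF// => /(_ erefl).
by apply: filterS => y /(_ I).
Qed.

(** The factor [(2 A)^-1] makes each step halve the norm. *)
Let step (w : Y -> R) (y : Y) : R := ((2 * A)^-1 * fine (M (complexify w) y))%R.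

Let step_ge0 w y : finite_norm_on w -> (0 <= step w y)%R.
Proof.
by move=> Fw; rewrite mulr_ge0 ?fine_ge0 ?M_ge0// invr_ge0 mulr_ge0// ltW.
Qed.

Let measurable_step w : finite_norm_on w -> measurable_fun setT (step w).
Proof.
move=> Fw; apply: measurable_funM => //.
by apply: measurableT_comp => //; exact: measurable_M.
Qed.

Let Lnorm_step w : finite_norm_on w ->
  Lnorm mu p%:E (EFin \o step w) <= 2^-1%:E * Lnorm mu p%:E (EFin \o w).
Proof.
move=> Fw; have mfM : measurable_fun setT (fun y => fine (M (complexify w) y)).
  by apply: measurableT_comp => //; exact: measurable_M.
rewrite LnormZ_EFin ?invr_ge0 ?mulr_ge0// ?(ltW A0)//.
have -> : (2^-1 = (2 * A)^-1 * A)%R.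
  by rewrite invfM -mulrA mulVf ?mulr1 ?gt_eqF.
rewrite EFinM -muleA lee_pmul2l ?lte_fin ?invr_gt0 ?mulr_gt0//.
apply: le_trans (LnormM_le Fw); apply: ge0_Lnorm_ae_le => //.
- exact/measurable_EFinP.
- exact: measurable_M.
by apply: filterS (M_fin Fw) => y Mfin; rewrite -[in leRHS](fineK Mfin).
Qed.

Variable g : Y -> R.
Hypotheses (mg : measurable_fun setT g) (g0 : forall y, (0 <= g y)%R).
Hypothesis gfin : Lnorm mu p%:E (EFin \o g) < +oo.

Let N := fine (Lnorm mu p%:E (EFin \o g)).
Let NE : Lnorm mu p%:E (EFin \o g) = N%:E.
Proof. by rewrite /N fineK// ge0_fin_numE ?Lnorm_ge0. Qed.
Let N0 : (0 <= N)%R. Proof. by rewrite fine_ge0// Lnorm_ge0. Qed.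

Let u k := iter k step g.
(* [2 N / 2 ^ (k + 1)] is [N / 2 ^ k], in the shape of a series summing to [2 N] *)
Let a k : \bar R := (2 * N / (2 ^ k.+1)%:R)%:E.

Let u_prop k : [/\ measurable_fun setT (u k), forall y, (0 <= u k y)%R &
  Lnorm mu p%:E (EFin \o u k) <= a k].
Proof.
elim: k => [|k [mk uk0 uka]].
  split => //; rewrite /= NE /a lee_fin expn1 mulrAC divff ?mul1r//.
have Fk : finite_norm_on (u k) by split => //; apply: le_lt_trans uka _; rewrite ltry.
split; first exact: measurable_step.
  by move=> y; exact: step_ge0.
apply: le_trans (Lnorm_step Fk) _.
apply: (@le_trans _ _ (2^-1%:E * a k)); first by rewrite lee_pmul2l// lte_fin.
rewrite /a -EFinM lee_fin (expnS 2 k.+1) natrM invfM.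
by rewrite le_eqVlt; apply/orP; left; apply/eqP; ring.
Qed.

Let mu_ k : measurable_fun setT (u k). Proof. by have [] := u_prop k. Qed.
Let u0 k y : (0 <= u k y)%R. Proof. by have [] := u_prop k. Qed.
Let ua k : Lnorm mu p%:E (EFin \o u k) <= a k. Proof. by have [] := u_prop k. Qed.

Let Fu k : finite_norm_on (u k).
Proof. by split => //; apply: le_lt_trans (ua k) _; rewrite ltry. Qed.

Let W y : \bar R := \sum_(k <oo) (u k y)%:E.
Let tail n y : \bar R := \sum_(k <oo) (u (k + n)%N y)%:E.
Let S n y : R := (\sum_(k < n) u k y)%R.

Let tail_ge0 n y : 0 <= tail n y.
Proof. by apply: nneseries_ge0 => k _ _; rewrite lee_fin. Qed.

Let measurable_tail n : measurable_fun setT (tail n).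
Proof.
apply: ge0_emeasurable_sum => // k; first by move=> y _ _; rewrite lee_fin.
by move=> _; apply/measurable_EFinP.
Qed.

Let WE n y : W y = (S n y)%:E + tail n y.
Proof.
have uE k : 0 <= (u k y)%:E by rewrite lee_fin.
rewrite /W (nneseries_split 0 n)// add0n /tail -nneseries_addn//.
by rewrite big_mkord sumEFin.
Qed.

Let Lnorm_tail n : Lnorm mu p%:E (tail n) <= (2 * N / (2 ^ n)%:R)%:E.
Proof.
have := @Lnorm_nneseries_le _ _ _ mu (fun k => u (k + n)%N) (fun k => a (k + n)%N)
  p (ltW p1) (fun k => mu_ (k + n)%N) (fun k => u0 (k + n)%N) (fun k => ua (k + n)%N).
move=> /le_trans; apply.
have e0 : (0 <= 2 * N / (2 ^ n)%:R)%R by rewrite divr_ge0// mulr_ge0.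
apply: le_trans (epsilon_trick0 xpredT e0); apply: lee_nneseries => k _.
  by rewrite lee_fin divr_ge0// mulr_ge0.
by rewrite /a lee_fin -addSn expnD natrM invfM mulrA mulrAC.
Qed.

Let W_fin : {ae mu, forall y, W y \is a fin_num}.
Proof.
have W0 y : W y = tail 0 y by rewrite (WE 0) /S big_ord0 add0e.
have := Lnorm_tail 0; rewrite ge0_LnormE// => /le_lt_trans/(_ (ltry _)) h.
have := @ae_fin_num_integral_poweR _ _ _ mu setT (tail 0) p measurableT
  (measurable_tail 0) (fun y _ => tail_ge0 0 y) p0 (lty_poweRy _ h).
rewrite invr_neq0 ?gt_eqF// => /(_ erefl).
by apply: filterS => y /(_ I); rewrite W0.
Qed.

Let w y : R := fine (W y).

Let mw : measurable_fun setT w.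
Proof.
have mW : measurable_fun setT W.
  apply: ge0_emeasurable_sum => // k; first by move=> y _ _; rewrite lee_fin.
  by move=> _; apply/measurable_EFinP.
exact: measurableT_comp.
Qed.

Let w0 y : (0 <= w y)%R.
Proof. by rewrite fine_ge0//; apply: nneseries_ge0 => k _ _; rewrite lee_fin. Qed.

Let mS n : measurable_fun setT (S n). Proof. exact: measurable_sum. Qed.

Let wE : {ae mu, forall y n, (w y - S n y)%:E = tail n y}.
Proof.
apply: filterS W_fin => y Wfin n; rewrite EFinB fineK//.
by rewrite (WE n) addeAC subee// add0e.
Qed.

Let Lnorm_remainder n :
  Lnorm mu p%:E (EFin \o (fun y => w y - S n y)%R) <= (2 * N / (2 ^ n)%:R)%:E.
Proof.
apply: le_trans (Lnorm_tail n); apply: ge0_Lnorm_ae_le => //.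
  by apply/measurable_EFinP; exact: measurable_funB.
by apply: filterS wE => y wEy; rewrite -wEy.
Qed.

Let Lnorm_w : Lnorm mu p%:E (EFin \o w) <= (2 * N)%:E.
Proof.
have := Lnorm_remainder 0; rewrite expn0 divr1.
suff -> : (fun y => w y - S 0 y)%R = w by [].
by apply/funext => y; rewrite /S big_ord0 subr0.
Qed.

Let Fw : finite_norm_on w.
Proof. by split => //; apply: le_lt_trans Lnorm_w _; rewrite ltry. Qed.

Let FS n : finite_norm_on (S n).
Proof.
split => //; have := @Lnorm_sum_le _ _ _ mu u a p n (ltW p1) mu_ ua.
by move=> /le_lt_trans; apply; rewrite /a sumEFin ltry.
Qed.

Let M_add f h : finite_norm_on f -> finite_norm_on h ->
  {ae mu, forall y, M (complexify (fun z => f z + h z)%R) y <=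
                    M (complexify f) y + M (complexify h) y}.
Proof.
move=> /L1loc_fn Lf /L1loc_fn Lh; have [_ /(_ _ _ Lf Lh) + _] := M_sub.
suff -> : complexify (fun z => f z + h z)%R =
          (fun z => complexify f z + complexify h z)%R by [].
by apply/funext => z; rewrite /complexify rmorphD.
Qed.

Let M_u k : {ae mu, forall y, M (complexify (u k)) y = (2 * A * u k.+1 y)%:E}.
Proof.
apply: filterS (M_fin (Fu k)) => y Mfin.
by rewrite /= /step mulrA divff ?mul1r ?fineK// gt_eqF// mulr_gt0.
Qed.

Let M_S n : {ae mu, forall y,
  M (complexify (S n.+1)) y <= (2 * A * (\sum_(k < n.+1) u k.+1 y))%:E}.
Proof.
elim: n => [|n ih].
  have -> : S 1 = u 0 by apply/funext => y; rewrite /S big_ord1.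
  by apply: filterS (M_u 0) => y ->; rewrite big_ord1.
have -> : S n.+2 = (fun y => S n.+1 y + u n.+1 y)%R.
  by apply/funext => y; rewrite /S big_ord_recr.
apply: filterS3 (M_add (FS n.+1) (Fu n.+1)) ih (M_u n.+1) => y h1 h2 h3.
apply: le_trans h1 _; rewrite h3 big_ord_recr/= mulrDr EFinD leeD//.
Qed.

Let M_w_le n : {ae mu, forall y, M (complexify w) y <=
  (2 * A * w y)%:E + M (complexify (fun z => w z - S n.+1 z)%R) y}.
Proof.
have Fr : finite_norm_on (fun z => w z - S n.+1 z)%R.
  split; first exact: measurable_funB.
  by apply: le_lt_trans (Lnorm_remainder _) _; rewrite ltry.
have := M_add (FS n.+1) Fr.
have -> : (fun z => S n.+1 z + (w z - S n.+1 z))%R = w.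
  by apply/funext => z; rewrite addrC subrK.
move=> h1; apply: filterS3 h1 (M_S n) wE => y h1 h2 h3.
apply: le_trans h1 _; rewrite leeD2r//; apply: le_trans h2 _.
rewrite lee_fin ler_pM2l ?mulr_gt0//.
have := h3 n.+2; have := tail_ge0 n.+2 y => /[swap] <-; rewrite lee_fin subr_ge0.
have -> : S n.+2 y = (u 0 y + \sum_(k < n.+1) u k.+1 y)%R.
  by rewrite /S big_ord_recl.
by apply: le_trans; rewrite lerDr.
Qed.

(* The excess of [M w] over [2 A w] is dominated by the image under [M] of each
   remainder of the series, so its norm is zero. *)
Let M_w : {ae mu, forall y, M (complexify w) y <= (2 * A)%:E * (w y)%:E}.
Proof.
pose h y := maxe (M (complexify w) y - (2 * A * w y)%:E) 0.
have mh : measurable_fun setT h.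
  apply: measurable_maxe => //; apply: emeasurable_funB; first exact: measurable_M.
  by apply/measurable_EFinP; apply: measurable_funM.
have h_le n : Lnorm mu p%:E h <= (A * (2 * N))%:E * ((2 ^ n.+1)%:R^-1)%:E.
  have Fr : finite_norm_on (fun z => w z - S n.+1 z)%R.
    split; first exact: measurable_funB.
    by apply: le_lt_trans (Lnorm_remainder _) _; rewrite ltry.
  apply: (@le_trans _ _ (A%:E * (2 * N / (2 ^ n.+1)%:R)%:E)); last first.
    by rewrite -!EFinM lee_fin !mulrA.
  apply: le_trans (_ : _ <= A%:E * Lnorm mu p%:E (EFin \o (fun z => w z - S n.+1 z)%R)) _; last first.
    by rewrite lee_pmul2l ?lte_fin//; exact: Lnorm_remainder.
  apply: le_trans (LnormM_le Fr); apply: ge0_Lnorm_ae_le => //.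
    exact: measurable_M.
  apply: filterS (M_w_le n) => y hy.
  have Mr0 := M_ge0 y Fr.
  rewrite !gee0_abs// ?le_max ?lexx ?orbT// ge_max Mr0 andbT.
  by rewrite leeBlDl// .
have h0 : Lnorm mu p%:E h = 0.
  apply/eqP; rewrite eq_le Lnorm_ge0 andbT; apply/lee_addgt0Pr => e e0.
  rewrite add0e.
  pose n := Num.truncn (A * (2 * N) / e)%R.
  apply: le_trans (h_le n) _; rewrite -EFinM lee_fin ler_pdivrMr ?ltr0n ?expn_gt0//.
  rewrite -ler_pdivrMl// [leLHS]mulrC.
  apply: le_trans (ltW (truncnS_gt _)) _.
  by rewrite ler_nat ltnW// ltn_expl.
have := Lnorm_eq0_eq0 mh (p0 : 0 < p%:E) h0.
apply: filterS => y /(_ I) hy.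
have : M (complexify w) y - (2 * A * w y)%:E <= 0 by rewrite -[leRHS]hy le_max lexx.
by rewrite leeBlDr// add0e EFinM.
Qed.

Let g_le_w : {ae mu, forall y, (g y <= w y)%R}.
Proof.
apply: filterS wE => y h.
have := h 1%N; have := tail_ge0 1%N y => /[swap] <-; rewrite lee_fin subr_ge0.
by rewrite /S big_ord1.
Qed.

(** The weight is the sum of the iterates of [M] at [g], the [k]-th divided by
    [(2 A)^k].  Applying [M] shifts the series and costs a factor [2 A].
    Subadditivity of [M] covers finite sums only, but the remainder of the
    series has arbitrarily small norm, hence so has its image under [M].
    Positivity of [g] is what makes the majorant a weight: nothing prevents
    [M] from vanishing where [g] does. *)
Lemma rubio_de_francia : {ae mu, forall y, (0 < g y)%R} ->
  exists w' : Y -> R, [/\ A1 mu BB M w', A1_const mu M w' <= (2 * A)%:E,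
    {ae mu, forall y, (g y <= w' y)%R} &
    Lnorm mu p%:E (EFin \o w') <= 2%:E * Lnorm mu p%:E (EFin \o g)].
Proof.
move=> gpos; exists w.
have A1b : A1_bound mu M w (2 * A) by split; [rewrite mulr_ge0// ltW|exact: M_w].
split => //.
- split; [by split => //; exact: L1loc_fn| |by exists (2 * A)%R].
  by apply: filterS2 g_le_w gpos => y h1 h2; exact: lt_le_trans h1.
- by apply: ereal_inf_lbound; exists (2 * A)%R.
- by apply: le_trans Lnorm_w _; rewrite NE EFinM.
Qed.

End rubio_de_francia.

(** * Positive functions on sigma-finite spaces *)

Section positive_function.
Context d (Y : measurableType d) (R : realType).
Variable mu : {sigma_finite_measure set Y -> \bar R}.

Lemma Lnorm_indic (D : set Y) (p : R) : measurable D -> (0 < p)%R ->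
  Lnorm mu p%:E (EFin \o \1_D) = mu D `^ p^-1.
Proof.
move=> mD p0; rewrite ge0_LnormE => [|y]; last by rewrite lee_fin.
congr (_ `^ _); rewrite -[RHS]mul1e -integral_cst// [RHS]integral_mkcond.
apply: eq_integral => y _; rewrite patchE/= indicE.
by case: (y \in D); rewrite ?powR1 ?powR0// gt_eqF.
Qed.

(** Weighted sum of the indicators of a countable cover by sets of finite
    measure, with weights making the norms summable. *)
Lemma exists_gt0_finite_Lnorm (p : R) : (1 <= p)%R ->
  exists h : Y -> R, [/\ measurable_fun setT h, forall y, (0 <= h y)%R,
    {ae mu, forall y, (0 < h y)%R} & Lnorm mu p%:E (EFin \o h) < +oo].
Proof.
move=> p1; have p0 : (0 < p)%R by exact: lt_le_trans p1.
have /sigma_finiteP[F [FT _ Ffin]] := sigma_finiteT mu.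
pose m k := fine (mu (F k) `^ p^-1).
have m0 k : (0 <= m k)%R by rewrite fine_ge0// poweR_ge0.
have mE k : mu (F k) `^ p^-1 = (m k)%:E.
  by rewrite fineK// ge0_fin_numE ?poweR_ge0// poweR_lty//; case: (Ffin k).
pose c k := (1 / (2 ^ k.+1)%:R / (1 + m k))%R.
have m1 k : (0 < 1 + m k)%R by rewrite ltr_pwDl.
have c0 k : (0 < c k)%R by rewrite !divr_gt0// ltr0n expn_gt0.
pose u k y := (c k * \1_(F k) y)%R.
have mI k : measurable_fun setT (\1_(F k) : Y -> R).
  by apply: measurable_indic; case: (Ffin k).
have mu_ k : measurable_fun setT (u k) by exact: measurable_funM.
have u0 k y : (0 <= u k y)%R by rewrite mulr_ge0// ltW.
have ua k : Lnorm mu p%:E (EFin \o u k) <= (1 / (2 ^ k.+1)%:R)%:E.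
  rewrite LnormZ_EFin ?(ltW (c0 k))// Lnorm_indic//; last by case: (Ffin k).
  rewrite mE -EFinM lee_fin /c mulrAC ler_pdivrMr// ler_wpM2l ?divr_ge0//.
  by rewrite lerDr.
pose W y := \sum_(k <oo) (u k y)%:E.
have uE0 y k : 0 <= (u k y)%:E by rewrite lee_fin.
have W0 y : 0 < W y.
  have [k _ Fky] : (\bigcup_k F k) y by rewrite -FT.
  apply: lt_le_trans (nneseries_lim_ge k.+1 (fun k _ _ => uE0 y k)).
  rewrite big_nat_recr//=; apply: (@lt_le_trans _ _ (u k y)%:E).
    by rewrite lte_fin /u indicE mem_set// mulr1.
  by rewrite leeDr// sume_ge0.
have mW : measurable_fun setT W.
  apply: ge0_emeasurable_sum => // k _; exact/measurable_EFinP.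
have NW : Lnorm mu p%:E W <= 1.
  apply: le_trans (Lnorm_nneseries_le p1 mu_ u0 ua) _.
  exact: epsilon_trick0.
have Wfin : {ae mu, forall y, W y \is a fin_num}.
  have := NW; rewrite ge0_LnormE => [/le_lt_trans/(_ (ltry _)) h|y]; last exact/ltW.
  have := @ae_fin_num_integral_poweR _ _ _ mu setT W p measurableT
    mW (fun y _ => ltW (W0 y)) p0 (lty_poweRy _ h).
  rewrite invr_neq0 ?gt_eqF// => /(_ erefl).
  by apply: filterS => y /(_ I).
exists (fine \o W); split.
- exact: measurableT_comp.
- by move=> y /=; rewrite fine_ge0// ltW.
- by apply: filterS Wfin => y; rewrite ge0_fin_numE ?ltW// => Wy; rewrite fine_gt0// W0.
- apply: le_lt_trans (_ : _ <= 1) (ltry _); apply: le_trans NW.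
  apply: ge0_Lnorm_ae_le => //.
    by apply/measurable_EFinP; exact: measurableT_comp.
  by apply: filterS Wfin => y Wy; rewrite -[in leRHS](fineK Wy).
Qed.

End positive_function.

(** * Conjugate exponents, suprema and averages *)

Section conjugate_exponents.
Context {R : realType}.
Implicit Types p : R.

Lemma conj_exp_gt1 p : (1 < p)%R -> (1 < conj_exp p)%R.
Proof.
by move=> p1; rewrite /conj_exp ltr_pdivlMr ?subr_gt0// mul1r ltrBlDr ltrDl.
Qed.

Lemma conj_expV p : (1 < p)%R -> (p^-1 + (conj_exp p)^-1 = 1)%R.
Proof.
move=> p1; have p0 : p != 0%R by rewrite gt_eqF// (lt_trans ltr01).
by rewrite /conj_exp invf_div; field.
Qed.

Lemma conj_expK p : (1 < p)%R -> conj_exp (conj_exp p) = p.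
Proof.
move=> p1; have pB : (p - 1)%R != 0%R by rewrite gt_eqF// subr_gt0.
have -> : (conj_exp (conj_exp p) = p / (p - 1) / (1 / (p - 1)))%R.
  by rewrite {1}/conj_exp; congr (_ / _)%R; rewrite /conj_exp; field.
by field.
Qed.

Lemma conj_exp_le p q : (1 < p)%R -> (p <= q)%R -> (conj_exp q <= conj_exp p)%R.
Proof.
move=> p1 pq; have q1 := lt_le_trans p1 pq.
rewrite /conj_exp ler_pdivrMr ?subr_gt0// mulrAC ler_pdivlMr ?subr_gt0//.
by rewrite !mulrBr !mulr1 [(q * p)%R]mulrC lerD2l lerN2.
Qed.

End conjugate_exponents.

Section suprema.
Context {R : realType}.
Implicit Types (S : set (\bar R)) (x : \bar R).

Lemma sup0_le S x : 0 <= x -> (forall y, S y -> y <= x) -> Defs.sup0 S <= x.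
Proof. by move=> x0 Sx; apply: ge_ereal_sup => y [/= ->//|]; exact: Sx. Qed.

Lemma le_sup0 S y : S y -> y <= Defs.sup0 S.
Proof. by move=> Sy; apply: ereal_sup_ubound; right. Qed.

Lemma sup0_ge0 S : 0 <= Defs.sup0 S.
Proof. by apply: ereal_sup_ubound; left. Qed.

End suprema.

Section averages.
Context d (Y : measurableType d) (R : realType).
Variables (mu : {measure set Y -> \bar R}) (B : set Y).
Hypothesis B_fin : 0 < mu B < +oo.

Lemma measure_fineE : mu B = (fine (mu B))%:E /\ (0 < fine (mu B))%R.
Proof.
have /andP[B0 By] := B_fin; rewrite fine_gt0 ?B0 ?By// fineK//.
by rewrite ge0_fin_numE.
Qed.

Lemma integral_avgE (g : Y -> \bar R) :
  \int[mu]_(y in B) g y = avg mu B g * mu B.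
Proof.
have [E m0] := measure_fineE; rewrite /avg E inver gt_eqF// -muleA -EFinM.
by rewrite mulVf ?gt_eqF// mule1.
Qed.

Lemma avg_ge0 (g : Y -> \bar R) : (forall y, B y -> 0 <= g y) -> 0 <= avg mu B g.
Proof.
by move=> g0; rewrite mule_ge0 ?integral_ge0// inve_ge0 ltW//; case/andP: B_fin.
Qed.

Lemma integral_avg_lty (g : Y -> \bar R) : (forall y, B y -> 0 <= g y) ->
  avg mu B g < +oo -> \int[mu]_(y in B) g y < +oo.
Proof.
move=> g0 gy; rewrite integral_avgE lte_mul_pinfty ?avg_ge0//.
  by rewrite ge0_fin_numE ?avg_ge0.
by case/andP: B_fin.
Qed.

End averages.

(** * Muckenhoupt weights *)

Section muckenhoupt_weights.
Context d (Y : measurableType d) (R : realType).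
Variables (mu : {measure set Y -> \bar R}) (BB : set (set Y)).
Hypothesis BB_meas : forall B, BB B -> measurable B.
Hypothesis BB_fin : forall B, BB B -> 0 < mu B < +oo.

(** On the set where [w] vanishes [neg_pow] is infinite, which a power of the
    real number [w y] cannot express. *)
Lemma measurable_neg_pow (w : Y -> R) s : measurable_fun setT w ->
  measurable_fun setT (neg_pow w s).
Proof.
move=> mw.
have mpow r : measurable_fun setT (fun y => w y `^ r)%R.
  exact: (measurableT_comp (measurable_powR r)).
rewrite (_ : neg_pow w s =
    fun y => if (w y `^ s)%R == 0%R then +oo else (w y `^ (- s))%:E); last first.
  by apply/funext => y; rewrite /neg_pow inver powRN.
apply: measurable_fun_ifT => //; first exact: measurable_fun_eqr.
exact/measurable_EFinP.
Qed.

Lemma neg_pow_ge0 (w : Y -> R) s y : 0 <= neg_pow w s y.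
Proof. by rewrite inve_ge0 lee_fin powR_ge0. Qed.

Variables (p : R) (w : Y -> R).
Hypotheses (p1 : (1 < p)%R) (wAp : Ap mu BB p w).

Let q := conj_exp p.
Let p0 : (0 < p)%R. Proof. exact: lt_trans p1. Qed.
Let q0 : (0 < q)%R. Proof. by rewrite (lt_trans ltr01)// conj_exp_gt1. Qed.

Lemma Ap_measurable : measurable_fun setT w.
Proof. by case: wAp => -[_ [/cmeasurable_complexify]]. Qed.

Lemma Ap_ge0 y : (0 <= w y)%R.
Proof. by case: wAp => -[]. Qed.

Section one_set.
Variable B : set Y.
Hypothesis BBB : BB B.

Let mB := BB_meas BBB.
Let fB := BB_fin BBB.

Let m_neg : measurable_fun B (neg_pow w (q / p)).
Proof. exact/measurable_funTS/measurable_neg_pow/Ap_measurable. Qed.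

Let wmeas_lty : wmeas mu w B < +oo.
Proof.
apply: (integral_avg_lty fB) => [y _|]; first by rewrite lee_fin Ap_ge0.
by case: wAp => _ /(_ B BBB)[].
Qed.

Let neg_lty : \int[mu]_(y in B) neg_pow w (q / p) y < +oo.
Proof.
apply: (integral_avg_lty fB) => [y _|]; first exact: neg_pow_ge0.
by case: wAp => _ /(_ B BBB)[].
Qed.

Let w_gt0 : {ae mu, forall y, B y -> (0 < w y)%R}.
Proof.
have := @ae_fin_num_integral_poweR _ _ _ mu B (neg_pow w (q / p)) 1 mB m_neg
  (fun y _ => neg_pow_ge0 w (q / p) y) ltr01.
under eq_integral do rewrite poweRe1 ?neg_pow_ge0//.
move=> /(_ neg_lty); apply: filterS => y h By; have := h By.
(* where [w] vanishes the dual weight is infinite *)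
rewrite lt0r Ap_ge0 andbT; apply: contraPneq => w0.
by rewrite /neg_pow w0 powR0 ?inve0// mulf_neq0 ?invr_neq0 ?gt_eqF.
Qed.

(** The constant 1 is the product of [w] to the power [p^-1] and its inverse,
    so this is Hoelder's inequality for the integral of 1 over [B].  It shows
    both that [w] has positive mass and that its characteristic is at least 1. *)
Lemma Ap_hoelder : mu B <= wmeas mu w B `^ p^-1 *
  (\int[mu]_(y in B) neg_pow w (q / p) y) `^ q^-1.
Proof.
have mw : measurable_fun B (EFin \o w).
  by apply/measurable_EFinP/measurable_funTS/Ap_measurable.
have := @ge0_hoelder _ _ _ mu B (fun y => (w y)%:E `^ p^-1)
  (fun y => neg_pow w (q / p) y `^ q^-1) p q mB
  (measurable_fun_poweR p^-1 mw) (measurable_fun_poweR q^-1 m_neg)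
  (fun _ _ => poweR_ge0 _ _) (fun _ _ => poweR_ge0 _ _) p0 q0 (conj_expV p1).
under [X in _ <= X `^ _ * _ -> _]eq_integral do
  rewrite -poweRrM mulVf ?gt_eqF// poweRe1 ?lee_fin ?Ap_ge0//.
under [X in _ <= _ * X `^ _ -> _]eq_integral do
  rewrite -poweRrM mulVf ?gt_eqF// poweRe1 ?neg_pow_ge0//.
apply: le_trans; rewrite -[leLHS]mul1e -integral_cst//.
apply: ae_ge0_le_integral => //.
- by move=> y _; rewrite mule_ge0 ?poweR_ge0.
- by apply: emeasurable_funM; exact: measurable_fun_poweR.
apply: filterS w_gt0 => y wy By; have {}wy := wy By.
have wN0 : (w y `^ (q / p))%R != 0%R by rewrite powR_eq0 gt_eqF.
rewrite /neg_pow inver (negbTE wN0) -powRN !poweR_EFin -EFinM lee_fin -powRrM.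
have -> : (- (q / p) * q^-1 = - p^-1)%R.
  by rewrite mulNr mulrAC divff ?mul1r// gt_eqF.
by rewrite powRN divff// powR_eq0 gt_eqF.
Qed.

Lemma Ap_wmeas : 0 < wmeas mu w B < +oo.
Proof.
rewrite wmeas_lty andbT lt0e; apply/andP; split; last first.
  by apply: integral_ge0 => y _; rewrite lee_fin Ap_ge0.
apply/eqP => w0; have := Ap_hoelder.
rewrite w0 poweR0r ?mul0e ?invr_neq0 ?gt_eqF// leNgt.
by case/andP: fB => ->.
Qed.

(** The reverse Hoelder data are monotone on characteristics at least one; this
    puts the characteristic of every weight in that range. *)
Lemma Ap_const_ge1 : 1 <= Ap_const mu BB p w.
Proof.
apply: le_trans (_ : _ <= Ap_prod mu p w B) _; last by apply: le_sup0; exists B.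
rewrite /Ap_prod -/q.
set V := avg mu B _; set U := avg mu B _.
have V0 : 0 <= V by apply: avg_ge0 => // y _; rewrite lee_fin Ap_ge0.
have U0 : 0 <= U by apply: avg_ge0 => // y _; exact: neg_pow_ge0.
have [mE m0] := measure_fineE fB.
have := Ap_hoelder; rewrite /wmeas !(integral_avgE fB) -/V -/U.
clearbody V U.
rewrite !poweRM// muleACA -poweRD; last first.
  by rewrite add_neq0_poweRD_def// conj_expV// oner_neq0.
rewrite conj_expV// poweRe1// -[leLHS]mul1e mE lee_pmul2r ?lte_fin// => h.
have := @poweR_le _ p _ _ (ltW p0) lee01 h.
rewrite poweR1r poweRM ?poweR_ge0// -!poweRrM mulVf ?gt_eqF// poweRe1//.
by rewrite mulrC.
Qed.

End one_set.
End muckenhoupt_weights.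

(** * Oscillation spaces *)

Section oscillation_norms.
Context d (Y : measurableType d) (R : realType).
Variables (mu : {measure set Y -> \bar R}) (BB : set (set Y)).
Hypothesis BB_meas : forall B, BB B -> measurable B.
Hypothesis BB_fin : forall B, BB B -> 0 < mu B < +oo.
Variables (F : Type) (Lam : F -> set Y -> Y -> \bar R).
Hypothesis Lam_osc : oscillation BB Lam.

Lemma Xnorm_ge0 w (p : R) f : 0 <= Xnorm mu BB Lam w p f.
Proof. exact: poweR_ge0. Qed.

Lemma Xnorm_le (w : Y -> R) (p : R) f c :
    (forall B, BB B -> 0 < wmeas mu w B < +oo) -> (0 < p)%R -> 0 <= c ->
    (forall B, BB B ->
      \int[mu]_(y in B) (Lam f B y `^ p * (w y)%:E) <= c `^ p * wmeas mu w B) ->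
  Xnorm mu BB Lam w p f <= c.
Proof.
move=> w0 p0 c0 H; rewrite /Xnorm poweRV_le ?sup0_ge0//.
apply: sup0_le => [|_ [B BBB <-]]; first exact: poweR_ge0.
have := H B BBB; have /andP[wB0 wBy] := w0 B BBB.
have wBE : wmeas mu w B = (fine (wmeas mu w B))%:E.
  by rewrite fineK// ge0_fin_numE// ltW.
have fB0 : (0 < fine (wmeas mu w B))%R by rewrite fine_gt0// wB0.
by rewrite wBE inver gt_eqF// lee_pdivrMr.
Qed.

Lemma integral_le_Xnorm (w : Y -> R) (p : R) f B :
    BB B -> 0 < wmeas mu w B < +oo -> (0 < p)%R ->
  \int[mu]_(y in B) (Lam f B y `^ p * (w y)%:E) <=
  Xnorm mu BB Lam w p f `^ p * wmeas mu w B.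
Proof.
move=> BBB /andP[wB0 wBy] p0.
have wBE : wmeas mu w B = (fine (wmeas mu w B))%:E.
  by rewrite fineK// ge0_fin_numE// ltW.
have fB0 : (0 < fine (wmeas mu w B))%R by rewrite fine_gt0// wB0.
rewrite /Xnorm poweRVK ?gt_eqF ?sup0_ge0// wBE -lee_pdivrMr//.
by apply: le_sup0; exists B => //; rewrite wBE inver gt_eqF.
Qed.

Lemma wmeas_one B : BB B -> wmeas mu Defs.one B = mu B.
Proof. by move=> BBB; rewrite -[RHS]mul1e -integral_cst//; exact: BB_meas. Qed.

Lemma Xnorm1_le (p : R) f c : (0 < p)%R -> 0 <= c ->
    (forall B, BB B -> \int[mu]_(y in B) (Lam f B y `^ p) <= c `^ p * mu B) ->
  Xnorm mu BB Lam Defs.one p f <= c.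
Proof.
move=> p0 c0 H; apply: Xnorm_le => // B BBB; rewrite wmeas_one//; first exact: BB_fin.
by under eq_integral do rewrite mule1; exact: H.
Qed.

Lemma integral_le_Xnorm1 (p : R) f B : BB B -> (0 < p)%R ->
  \int[mu]_(y in B) (Lam f B y `^ p) <= Xnorm mu BB Lam Defs.one p f `^ p * mu B.
Proof.
move=> BBB p0; rewrite -(wmeas_one BBB).
have := @integral_le_Xnorm Defs.one p f B BBB; rewrite wmeas_one// BB_fin// => /(_ erefl p0).
by under eq_integral do rewrite mule1.
Qed.

Lemma measurable_Lam f B : BB B -> measurable_fun B (Lam f B).
Proof. by move=> BBB; apply: measurable_funTS; have [] := Lam_osc f BBB. Qed.

Lemma Lam_ge0 f B y : BB B -> 0 <= Lam f B y.
Proof. by move=> BBB; have [_] := Lam_osc f BBB. Qed.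

Lemma Xnorm_exponent_le (s r : R) f : (0 < s)%R -> (s <= r)%R ->
  Xnorm mu BB Lam Defs.one s f <= Xnorm mu BB Lam Defs.one r f.
Proof.
move=> s0 sr; apply: Xnorm1_le => //; first exact: Xnorm_ge0.
move=> B BBB; apply: (@integral_poweR_exponent_le _ _ _ mu B (Lam f B) s r) => //.
- exact: BB_meas.
- exact: measurable_Lam.
- by move=> y _; exact: Lam_ge0.
- exact: Xnorm_ge0.
- by apply: integral_le_Xnorm1 => //; exact: lt_le_trans sr.
Qed.

End oscillation_norms.

(** * Weight invariance and the John-Nirenberg property *)

Section john_nirenberg.
Context d (Y : measurableType d) (R : realType).
Variables (mu : {sigma_finite_measure set Y -> \bar R}) (BB : set (set Y)).
Hypothesis BB_meas : forall B, BB B -> measurable B.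
Hypothesis BB_fin : forall B, BB B -> 0 < mu B < +oo.
Variables (F : Type) (Lam : F -> set Y -> Y -> \bar R).
Hypothesis Lam_osc : oscillation BB Lam.

Local Notation XN w p f := (Xnorm mu BB Lam w p f).
Local Notation X1 p f := (Xnorm mu BB Lam Defs.one p f).

Lemma Psi_ge0 p t : 0 <= Psi mu BB Lam p t.
Proof. exact: sup0_ge0. Qed.

Lemma Xnorm_le_Psi p t v f : Psi mu BB Lam p t < +oo ->
    Ap mu BB p v -> Ap_const mu BB p v <= t -> X1 1 f < +oo ->
  XN v 1 f <= Psi mu BB Lam p t * X1 1 f.
Proof.
move=> Psiy vAp vt f1.
have f1E : X1 1 f = (fine (X1 1 f))%:E by rewrite fineK// ge0_fin_numE ?Xnorm_ge0.
have bPsi : b_const mu BB Lam Defs.one v <= Psi mu BB Lam p t.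
  by apply: le_sup0; exists v.
apply: le_trans (lee_wpmul2r (Xnorm_ge0 _ _ _ _ _ _) bPsi).
rewrite f1E; apply: le_ereal_infM.
- by move=> C [/ltW].
- by rewrite fine_ge0// Xnorm_ge0.
- exact: le_lt_trans bPsi Psiy.
- by move=> C [_ HC]; rewrite -f1E; exact: HC.
Qed.

Section extrapolation.
Variable M : (Y -> R[i]) -> Y -> \bar R.
Hypothesis M_sub : sublinear_operator mu BB M.
Hypothesis hA1 : A1_sub_Ap mu BB M.
Hypothesis hA3 : forall p : R, (1 < p)%R -> 0 < opnorm mu M p < +oo.

Variables (p : R) (f : F).
Hypothesis p1 : (1 < p)%R.

Let q := conj_exp p.
Let q1 : (1 < q)%R. Proof. exact: conj_exp_gt1. Qed.
Let p0 : (0 < p)%R. Proof. exact: lt_trans p1. Qed.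
Let q0 : (0 < q)%R. Proof. exact: lt_trans q1. Qed.
Let pq : (p^-1 + q^-1 = 1)%R. Proof. exact: conj_expV. Qed.
Let qp : (q^-1 + p^-1 = 1)%R. Proof. by rewrite addrC. Qed.

Let psi := Psi mu BB Lam q (2%:E * opnorm mu M q).
Hypothesis psiy : psi < +oo.
Hypothesis f1 : X1 1 f < +oo.

Let psi0 : 0 <= psi. Proof. exact: Psi_ge0. Qed.

(** A positive [g] in the dual space is dominated by a weight of controlled
    characteristic and comparable norm, whose mass on [B] is again controlled
    by Hoelder's inequality. *)
Let pairing_gt0_le B (g : Y -> R) : BB B -> measurable_fun setT g ->
    (forall y, 0 <= g y)%R -> {ae mu, forall y, (0 < g y)%R} ->
    Lnorm mu q%:E (EFin \o g) < +oo ->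
  \int[mu]_(y in B) (Lam f B y * (g y)%:E) <=
  psi * X1 1 f * (2%:E * Lnorm mu q%:E (EFin \o g) * mu B `^ p^-1).
Proof.
move=> BBB mg g0 gpos gy.
have /andP[A0 Ay] := hA3 q1.
have AE : opnorm mu M q = (fine (opnorm mu M q))%:E.
  by rewrite fineK// ge0_fin_numE// ltW.
have fA0 : (0 < fine (opnorm mu M q))%R by rewrite fine_gt0// A0.
have [w [wA1 wA gw wN]] :=
  rubio_de_francia BB_meas BB_fin M_sub q1 p0 qp AE fA0 mg g0 gy gpos.
have [wAp wAle] := hA1 wA1 q1.
have wle : Ap_const mu BB q w <= 2%:E * opnorm mu M q.
  by apply: le_trans wAle _; rewrite AE -EFinM.
have mw := Ap_measurable wAp.
have w0 := Ap_ge0 wAp.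
have wB := Ap_wmeas BB_meas BB_fin q1 wAp BBB.
have mB := BB_meas BBB.
have mL := measurable_Lam Lam_osc f BBB.
have L0 y := Lam_ge0 Lam_osc f y BBB.
have mE (h : Y -> R) : measurable_fun setT h -> measurable_fun B (EFin \o h).
  by move=> mh; apply/measurable_EFinP; exact: measurable_funTS.
apply: (@le_trans _ _ (\int[mu]_(y in B) (Lam f B y * (w y)%:E))).
  apply: ae_ge0_le_integral => //.
  - by move=> y _; rewrite mule_ge0// lee_fin.
  - by apply: emeasurable_funM => //; exact: mE.
  - by move=> y _; rewrite mule_ge0// lee_fin.
  - by apply: emeasurable_funM => //; exact: mE.
  - by apply: filterS gw => y gwy _; rewrite lee_wpmul2l// lee_fin.
have := @integral_le_Xnorm _ _ _ mu BB F Lam w 1 f B BBB wB ltr01.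
under eq_integral do rewrite poweRe1//.
rewrite poweRe1 ?Xnorm_ge0// => /le_trans; apply.
apply: lee_pmul.
- exact: Xnorm_ge0.
- by case/andP: wB => /ltW.
- exact: Xnorm_le_Psi.
apply: le_trans (integral_le_Lnorm mu mB mw w0 q0 p0 qp) _.
by rewrite lee_wpmul2r ?poweR_ge0.
Qed.

(* Adding a small multiple of a positive function makes [g] positive. *)
Let pairing_le B (g : Y -> R) : BB B -> measurable_fun setT g ->
    (forall y, 0 <= g y)%R -> Lnorm mu q%:E (EFin \o g) < +oo ->
  \int[mu]_(y in B) (Lam f B y * (g y)%:E) <=
  psi * X1 1 f * (2%:E * Lnorm mu q%:E (EFin \o g) * mu B `^ p^-1).
Proof.
move=> BBB mg g0 gy.
have [h [mh h0 hpos hy]] := exists_gt0_finite_Lnorm mu (ltW q1).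
have fineE (x : \bar R) : 0 <= x -> x < +oo -> x = (fine x)%:E.
  by move=> x0 xy; rewrite fineK// ge0_fin_numE.
have gE := fineE _ (Lnorm_ge0 _ _ _) gy.
have hE := fineE _ (Lnorm_ge0 _ _ _) hy.
have psiE := fineE _ psi0 psiy.
have f1E := fineE _ (Xnorm_ge0 _ _ _ _ _ _) f1.
have muBE : mu B `^ p^-1 = (fine (mu B `^ p^-1))%:E.
  apply: fineE; first exact: poweR_ge0.
  by apply: poweR_lty; have /andP[] := BB_fin BBB.
pose N := fine (Lnorm mu q%:E (EFin \o g)); rewrite -/N in gE.
pose H := fine (Lnorm mu q%:E (EFin \o h)); rewrite -/H in hE.
pose m := fine (mu B `^ p^-1); rewrite -/m in muBE.
have N0 : (0 <= N)%R by exact/fine_ge0/Lnorm_ge0.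
have H0 : (0 <= H)%R by exact/fine_ge0/Lnorm_ge0.
have m0 : (0 <= m)%R by exact/fine_ge0/poweR_ge0.
pose K := (fine psi * fine (X1 1 f))%R.
have K0 : (0 <= K)%R by rewrite mulr_ge0// fine_ge0// Xnorm_ge0.
have c0 : (0 <= K * 2 * H * m)%R by do 3 (apply: mulr_ge0 => //).
apply/lee_addgt0Pr => e e0.
(* the error produced by [eps * h] is [eps * (K * 2 * H * m)], below [e] *)
pose eps := (e / (K * 2 * H * m + 1))%R.
have c1 : (0 < K * 2 * H * m + 1)%R by rewrite ltr_wpDl.
have eps0 : (0 < eps)%R by rewrite divr_gt0.
pose g' y := (g y + eps * h y)%R.
have meh : measurable_fun setT (fun y => eps * h y)%R by exact: measurable_funM.
have mg' : measurable_fun setT g' by exact: measurable_funD.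
have g'0 y : (0 <= g' y)%R by rewrite addr_ge0// mulr_ge0// ltW.
have g'pos : {ae mu, forall y, (0 < g' y)%R}.
  by apply: filterS hpos => y hy0; rewrite ltr_wpDl// mulr_gt0.
have g'N : Lnorm mu q%:E (EFin \o g') <= (N + eps * H)%:E.
  apply: le_trans (minkowski_EFin mu mg meh (ltW q1)) _.
  by rewrite LnormZ_EFin ?(ltW eps0)// gE hE.
have g'y : Lnorm mu q%:E (EFin \o g') < +oo by exact: le_lt_trans g'N (ltry _).
apply: (@le_trans _ _ (\int[mu]_(y in B) (Lam f B y * (g' y)%:E))).
  have mL := measurable_Lam Lam_osc f BBB.
  have L0 y := Lam_ge0 Lam_osc f y BBB.
  have mE (k : Y -> R) : measurable_fun setT k -> measurable_fun B (EFin \o k).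
    by move=> mk; apply/measurable_EFinP; exact: measurable_funTS.
  apply: ge0_le_integral.
  - exact: BB_meas.
  - by move=> y _; rewrite mule_ge0// lee_fin.
  - by apply: emeasurable_funM => //; exact: mE.
  - by apply: emeasurable_funM => //; exact: mE.
  - move=> y _; rewrite lee_wpmul2l// lee_fin lerDl mulr_ge0//.
    exact: ltW.
apply: le_trans (pairing_gt0_le BBB mg' g'0 g'pos g'y) _.
rewrite psiE f1E gE muBE.
apply: (@le_trans _ _ ((fine psi)%:E * (fine (X1 1 f))%:E *
    (2%:E * (N + eps * H)%:E * m%:E))).
  rewrite lee_wpmul2l ?mule_ge0 ?lee_fin ?fine_ge0 ?Xnorm_ge0//.
  by rewrite lee_wpmul2r ?lee_fin// lee_wpmul2l.
rewrite -!EFinM -EFinD lee_fin -/K.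
have -> : (K * (2 * (N + eps * H) * m) =
           K * (2 * N * m) + eps * (K * 2 * H * m))%R by ring.
rewrite lerD2l /eps mulrAC ler_pdivrMr// ler_pM2l//.
by rewrite lerDl.
Qed.

(** This is the bound of the theorem: converse Hoelder turns the estimate of
    the pairings into one of the norm on each [B]. *)
Lemma Xnorm_le_dual_Psi : X1 p f <= 2%:E * psi * X1 1 f.
Proof.
have c0 : 0 <= 2%:E * psi * X1 1 f by rewrite !mule_ge0// Xnorm_ge0.
apply: Xnorm1_le => // B BBB.
rewrite -[X in _ <= _ * X](@poweRVK _ p) ?gt_eqF// -poweRM ?poweR_ge0//.
apply: (@converse_hoelder _ _ _ mu B (Lam f B) p q) => //.
- exact: BB_meas.
- by case/andP: (BB_fin BBB).
- exact: (measurable_Lam Lam_osc f BBB).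
- by move=> y _; exact: (Lam_ge0 Lam_osc f y BBB).
- by rewrite mule_ge0 ?poweR_ge0.
move=> g mg g0 gy; apply: le_trans (pairing_le BBB mg g0 gy) _.
rewrite le_eqVlt; apply/orP; left; apply/eqP.
by rewrite (AC (2*(2*1)) (3*1*2*5*4)).
Qed.

End extrapolation.

Lemma JN_bound_of_Psi M (p c : R) : sublinear_operator mu BB M ->
    A1_sub_Ap mu BB M ->
    (forall p : R, (1 < p)%R -> 0 < opnorm mu M p < +oo) ->
    (1 < p)%R -> (0 < c)%R ->
    2%:E * Psi mu BB Lam (conj_exp p) (2%:E * opnorm mu M (conj_exp p)) <= c%:E ->
  JN_bound mu BB Lam 1 p c.
Proof.
move=> M_sub hA1 hA3 p1 c0 Psic; split => // f f1.
have psiy : Psi mu BB Lam (conj_exp p) (2%:E * opnorm mu M (conj_exp p)) < +oo.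
  rewrite ltey; apply: contraTneq Psic => ->.
  by rewrite gt0_muley ?lte_fin// -ltNge ltry.
apply: le_trans (Xnorm_le_dual_Psi M_sub hA1 hA3 p1 psiy f1) _.
by rewrite lee_wpmul2r// Xnorm_ge0.
Qed.

(** A weight [v] satisfies a reverse Hoelder inequality with some exponent
    [delta], so Hoelder's inequality with [delta] and its conjugate [s] bounds
    [Lam] averaged against [v] by the norm of exponent [s].  Over all weights
    of characteristic at most [T] the exponent [delta] is bounded below and
    the constant above, hence [s] stays below a fixed [s1]. *)
Lemma Psi_lty (q T : R) : quantitative_RH mu BB -> (1 < q)%R ->
    (forall s : R, (1 < s)%R -> exists C : R, JN_bound mu BB Lam 1 s C) ->
  Psi mu BB Lam q T%:E < +oo.
Proof.
move=> [Delta [K [DK1 _ DKt HRH]]] q1 HJ.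
(* the reverse Hoelder data concern characteristics at least one *)
pose T1 : R := Num.max 1%R T.
have T11 : (1 <= T1)%R by rewrite le_max lexx.
have [D1 K1] := DK1 q T1 q1 T11.
pose s1 := conj_exp (Delta q T1).
have s11 : (1 < s1)%R by exact: conj_exp_gt1.
have [C [C0 HC]] := HJ s1 s11.
(* any constant above [K q T1] is admissible for the reverse Hoelder infimum *)
pose K' := (K q T1 + 1)%R.
have K'0 : (0 < K')%R by rewrite addr_gt0// (lt_trans ltr01).
apply: (@le_lt_trans _ _ (K' * C)%:E); last exact: ltry.
apply: sup0_le; first by rewrite lee_fin mulr_ge0 ?ltW.
move=> _ [v [vAp vT] <-].
apply: ereal_inf_lbound; exists (K' * C)%R => //; split; first by rewrite mulr_gt0.
move=> f f1; apply: Xnorm_le => //.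
- by move=> B BBB; exact: (Ap_wmeas BB_meas BB_fin q1 vAp BBB).
- by rewrite mule_ge0 ?lee_fin ?mulr_ge0 ?Xnorm_ge0// ltW.
move=> B BBB; rewrite poweRe1; last first.
  by rewrite mule_ge0 ?lee_fin ?mulr_ge0 ?Xnorm_ge0// ltW.
under eq_integral do rewrite poweRe1 ?(Lam_ge0 Lam_osc)//.
have tge1 := Ap_const_ge1 BB_meas BB_fin q1 vAp BBB.
have tfin : Ap_const mu BB q v \is a fin_num.
  by rewrite ge0_fin_numE ?sup0_ge0//; case: vAp.
have {HRH} := HRH q v q1 vAp; set t := fine _.
have t1 : (1 <= t)%R by rewrite -lee_fin /t fineK.
have tT1 : (t <= T1)%R.
  by rewrite le_max -!lee_fin /t fineK// vT orbT.
have [Dt1 _] := DK1 q t q1 t1.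
have [Dle Kle] := DKt q t T1 q1 t1 tT1.
move=> [_ RHt].
set delta := Delta q t in Dt1 Dle RHt *.
pose s := conj_exp delta.
have s_gt1 : (1 < s)%R by exact: conj_exp_gt1.
have ss1 : (s <= s1)%R by exact: conj_exp_le.
have delta0 : (0 < delta)%R by exact: lt_trans Dt1.
have s0 : (0 < s)%R by exact: lt_trans s_gt1.
have [_ [c [c0 HcB] <-] cK] : exists2 y : \bar R,
    [set c%:E | c in RH_bound mu BB delta v] y & y < K'%:E.
  apply: ereal_inf_lt; apply: le_lt_trans RHt _.
  by rewrite lte_fin /K' (le_lt_trans Kle)// ltrDl.
have v0 := Ap_ge0 vAp.
have mv := Ap_measurable vAp.
have mB := BB_meas BBB.
have mL := measurable_Lam Lam_osc f BBB.
have L0 y := Lam_ge0 Lam_osc f y BBB.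
have mEv : measurable_fun B (EFin \o v).
  by apply/measurable_EFinP; exact: measurable_funTS.
have sdelta : (s^-1 + delta^-1 = 1)%R by rewrite addrC conj_expV.
have := @ge0_hoelder _ _ _ mu B (Lam f B) (EFin \o v) s delta mB mL mEv
  (fun y _ => L0 y) (fun y _ => v0 y) s0 delta0 sdelta.
move=> /le_trans; apply.
have Xs0 : 0 <= X1 s f by exact: Xnorm_ge0.
apply: (@le_trans _ _ ((X1 s f `^ s * mu B) `^ s^-1 *
    ((c%:E * avg mu B (EFin \o v)) * mu B `^ delta^-1))).
  apply: lee_pmul; rewrite ?poweR_ge0//.
    apply: poweR_le; first by rewrite invr_ge0 ltW.
      by apply: integral_ge0 => y _; exact: poweR_ge0.
    exact: integral_le_Xnorm1.
  rewrite (integral_avgE (BB_fin BBB)) poweRM//; last first.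
    by apply: (avg_ge0 (BB_fin BBB)) => y _; exact: poweR_ge0.
  by rewrite lee_wpmul2r ?poweR_ge0//; exact: HcB.
have VE : avg mu B (EFin \o v) * mu B = wmeas mu v B.
  by rewrite -(integral_avgE (BB_fin BBB)).
set V := avg mu B _ in VE *; clearbody V.
rewrite poweRM ?poweR_ge0// poweRK ?gt_eqF// muleACA -poweRD; last first.
  by rewrite add_neq0_poweRD_def// sdelta oner_neq0.
rewrite sdelta poweRe1// -!muleA VE.
rewrite EFinM -!muleA muleCA.
have [X10 W0] : 0 <= X1 1 f /\ 0 <= wmeas mu v B.
  by rewrite Xnorm_ge0; split => //; apply: integral_ge0 => y _; rewrite lee_fin.
apply: lee_pmul; rewrite ?mule_ge0 ?lee_fin//; first exact/ltW.
rewrite muleA lee_wpmul2r//.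
by apply: le_trans (HC f f1); apply: Xnorm_exponent_le.
Qed.

(** Hoelder's inequality splits [Lam] into the powers [p / 2] and [1 - p / 2].
    The norm of exponent [2 - p], greater than one, is at most a multiple of
    the norm of exponent one, which is finite and can be divided out. *)
Lemma JN_bound_lt1 (p c : R) : (0 < p < 1)%R ->
    JN_bound mu BB Lam 1 (2 - p) c ->
  JN_bound mu BB Lam p 1 (c `^ ((2 - p) / p))%R.
Proof.
move=> /andP[p0 p1] [c0 Hc]; split; first exact: powR_gt0.
move=> f f1; set r := (2 - p)%R in Hc *.
have r0 : (0 < r)%R by rewrite subr_gt0; lra.
have pr : (p / 2 + r / 2 = 1)%R by rewrite /r; field.
have pr0 : (p / 2 + r / 2 != 0)%R by rewrite pr oner_neq0.
have gt02 : (0 < 2 :> R)%R by [].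
have h2 : (2^-1 + 2^-1 = 1 :> R)%R by field.
have Xge0 s : 0 <= X1 s f by exact: Xnorm_ge0.
have interp : X1 1 f <= X1 p f `^ (p / 2) * X1 r f `^ (r / 2).
  apply: Xnorm1_le; rewrite ?mule_ge0 ?poweR_ge0// => B BBB.
  have mB := BB_meas BBB.
  have mL := measurable_Lam Lam_osc f BBB.
  have L0 y := Lam_ge0 Lam_osc f y BBB.
  have := @ge0_hoelder _ _ _ mu B (fun y => Lam f B y `^ (p / 2))
    (fun y => Lam f B y `^ (r / 2)) 2 2 mB
    (measurable_fun_poweR (p / 2) mL) (measurable_fun_poweR (r / 2) mL)
    (fun _ _ => poweR_ge0 _ _) (fun _ _ => poweR_ge0 _ _) gt02 gt02 h2.
  under [X in X <= _ -> _]eq_integral do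
    rewrite -poweRD ?add_neq0_poweRD_def// pr.
  under [X in _ <= X `^ _ * _ -> _]eq_integral do rewrite -poweRrM divfK//.
  under [X in _ <= _ * X `^ _ -> _]eq_integral do rewrite -poweRrM divfK//.
  move=> /le_trans; apply.
  apply: (@le_trans _ _ ((X1 p f `^ p * mu B) `^ 2^-1 *
                         (X1 r f `^ r * mu B) `^ 2^-1)).
    apply: lee_pmul; rewrite ?poweR_ge0//; apply: poweR_le => //.
    - by apply: integral_ge0 => y _; exact: poweR_ge0.
    - exact: integral_le_Xnorm1.
    - by apply: integral_ge0 => y _; exact: poweR_ge0.
    - exact: integral_le_Xnorm1.
  move: (X1 p f) (X1 r f) (Xge0 p) (Xge0 r) => a b a0 b0.
  rewrite !poweRM ?poweR_ge0// -!poweRrM muleACA -[in leLHS]poweRD; last first.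
    by rewrite add_neq0_poweRD_def// h2 oner_neq0.
  by rewrite h2 !mulr1 !poweRe1// mule_ge0 ?poweR_ge0.
have [f10|f1N0] := eqVneq (X1 1 f) 0.
  by rewrite f10 mule_ge0// lee_fin powR_ge0.
have f1gt0 : 0 < X1 1 f by rewrite lt0e f1N0 Xge0.
have : X1 1 f <= X1 p f `^ (p / 2) * (c%:E * X1 1 f) `^ (r / 2).
  apply: le_trans interp _; rewrite lee_wpmul2l ?poweR_ge0// poweR_le//.
    by rewrite divr_ge0// ltW.
  exact: Hc.
have c0' : 0 <= c%:E by rewrite lee_fin ltW.
have f1y : X1 1 f < +oo by exact: f1.
move: f1gt0 f1y (Xge0 1%R) (Xge0 p).
move: (X1 1 f) (X1 p f) => n b n_gt0 ny n0 b0.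
rewrite -[leLHS]poweRe1// -pr poweRD ?add_neq0_poweRD_def// pr poweRM// muleA.
rewrite lee_pmul2r ?poweR_gt0//; last first.
  by rewrite fin_num_poweR// ge0_fin_numE.
have p20 : (0 <= 2 / p)%R by rewrite divr_ge0// ltW.
move=> /(poweR_le p20 (poweR_ge0 _ _)).
have p2p : (p / 2 * (2 / p) = 1)%R by field; rewrite gt_eqF.
have r2p : (r / 2 * (2 / p) = r / p)%R by field; rewrite gt_eqF.
by rewrite poweRM ?poweR_ge0// -!poweRrM p2p r2p !poweRe1// muleC.
Qed.

Lemma power_JN_gt0 :
    (forall s : R, (1 < s)%R -> exists C : R, JN_bound mu BB Lam 1 s C) ->
  power_JN mu BB Lam `]0%R, +oo[.
Proof.
move=> HJ p q; rewrite !in_itv/= !andbT => p0 q0 pq.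
have [p1|p1] := leP 1%R p.
  have [C [C0 HC]] := HJ q (le_lt_trans p1 pq).
  exists C; split => // f f1; apply: le_trans (HC f f1) _.
  by rewrite lee_wpmul2l ?lee_fin ?(ltW C0)//; apply: Xnorm_exponent_le.
have [c Hc] := HJ (2 - p)%R ltac:(lra).
have [C'0 HC'] := JN_bound_lt1 (introT andP (conj p0 p1)) Hc.
set C' := (_ `^ _)%R in C'0 HC'.
pose s : R := Num.max q 2%R.
have s1 : (1 < s)%R by rewrite lt_max ltr1n orbT.
have [C [C0 HC]] := HJ s s1.
exists (C * C')%R; split => [|f f1]; first exact: mulr_gt0.
apply: le_trans (_ : _ <= X1 s f) _.
  by apply: Xnorm_exponent_le => //; rewrite le_max lexx.
apply: le_trans (HC f f1) _; rewrite EFinM -muleA lee_wpmul2l ?lee_fin ?(ltW C0)//.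
exact: HC'.
Qed.

End john_nirenberg.

Theorem theorem4p2 (R : realType) (d : measure_display) (Y : measurableType d)
    (mu : {sigma_finite_measure set Y -> \bar R}) (BB : set (set Y))
    (BB_meas : forall B, BB B -> measurable B)
    (BB_fin : forall B, BB B -> 0 < mu B < +oo)
    (M : (Y -> R[i]) -> Y -> \bar R) (M_sub : sublinear_operator mu BB M)
    (F : Type) (Lam : F -> set Y -> Y -> \bar R) (Lam_osc : oscillation BB Lam)
    (hA1 : A1_sub_Ap mu BB M)
    (hA2 : Ainfty_eq_RH mu BB)
    (hA3 : opnorm_blowup mu M)
    (hA4 : quantitative_RH mu BB)
    (hX : exists p0 : R, [/\ (1 < p0)%R,
       weight_invariance mu BB Lam (Ap mu BB p0) &
       forall p : R, (1 < p < p0)%R ->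
         Psi mu BB Lam p (2%:E * opnorm mu M p) < +oo]) :
  power_JN mu BB Lam `]0%R, +oo[ /\
  (forall p : R, (1 < p)%R ->
     JN_const mu BB Lam 1 p <=
       2%:E * Psi mu BB Lam (conj_exp p) (2%:E * opnorm mu M (conj_exp p)) /\
     2%:E * Psi mu BB Lam (conj_exp p) (2%:E * opnorm mu M (conj_exp p)) < +oo).
Proof.
have hM : forall p : R, (1 < p)%R -> 0 < opnorm mu M p < +oo by case: hA3.
have [p0 [p01 _ hPsi]] := hX.
pose Psi2 p := 2%:E * Psi mu BB Lam (conj_exp p) (2%:E * opnorm mu M (conj_exp p)).
have Psi2_ge0 p : 0 <= Psi2 p by rewrite mule_ge0// Psi_ge0.
have bound p e : (1 < p)%R -> (0 < e)%R -> Psi2 p < +oo ->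
    JN_bound mu BB Lam 1 p (fine (Psi2 p) + e).
  move=> p1 e0 Psiy; apply: (JN_bound_of_Psi BB_meas BB_fin Lam_osc M_sub) => //.
    by rewrite ltr_wpDl// fine_ge0.
  by rewrite -/(Psi2 p) [leRHS]EFinD fineK ?ge0_fin_numE// leeDl// lee_fin ltW.
(* Raising [s] until its conjugate exponent is below [p0] brings the hypothesis
   on [Psi] into play. *)
have HJ s : (1 < s)%R -> exists C : R, JN_bound mu BB Lam 1 s C.
  move=> s1; pose m := ((1 + p0) / 2)%R.
  have m1 : (1 < m)%R by rewrite /m; lra.
  have mp0 : (m < p0)%R by rewrite /m; lra.
  pose r := Num.max s (conj_exp m).
  have r1 : (1 < r)%R by rewrite lt_max s1.
  have rp0 : (1 < conj_exp r < p0)%R.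
    rewrite conj_exp_gt1//=; apply: le_lt_trans mp0; rewrite -[leRHS](conj_expK m1).
    by apply: conj_exp_le; rewrite ?conj_exp_gt1// le_max lexx orbT.
  have [C0 HC] : JN_bound mu BB Lam 1 r (fine (Psi2 r) + 1).
    by apply: bound => //; rewrite lte_mul_pinfty// hPsi.
  exists (fine (Psi2 r) + 1)%R; split => // f f1; apply: le_trans (HC f f1).
  by apply: Xnorm_exponent_le; rewrite ?(lt_trans ltr01)// le_max lexx.
split; first exact: power_JN_gt0.
move=> p p1; have q1 := conj_exp_gt1 p1.
have Psiy : Psi2 p < +oo.
  rewrite lte_mul_pinfty//; have /andP[A0 Ay] := hM _ q1.
  rewrite -(@fineK _ (opnorm mu M (conj_exp p))) ?ge0_fin_numE ?(ltW A0)//.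
  by rewrite -EFinM; exact: Psi_lty.
split => //; apply/lee_addgt0Pr => e e0.
rewrite -/(Psi2 p) -(@fineK _ (Psi2 p)) ?ge0_fin_numE// -EFinD.
by apply: ereal_inf_lbound; exists (fine (Psi2 p) + e)%R => //; exact: bound.
Qed.
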